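(* Let $\mathscr{V}=(\{\mathcal{V}_t\},\{\alpha^{s\to t}\},\{\beta^{t\to s}\})$ be a vineyard module segment over $[T_m,T_{m+1}]$. Then $\mathscr{V}$ can be forwards simplified; that is, for any initial choice of extended bases $\{B_t^{old}\}_{t\in[T_m,T_{m+1}]}$ there exists a forwards simplified family of extended bases $\{B_t^{new}\}_{t\in[T_m,T_{m+1}]}$.
   Context: Fix a field. A persistence module $\mathcal{X}$ is a family of vector spaces $(X_h)_{h\in\mathbb{R}}$ with transition maps $\phi_g^h:X_g\to X_h$ for $g\le h$, $\phi_h^h=\mathrm{id}$, $\phi_g^h\phi_f^g=\phi_f^h$. All persistence modules are assumed isomorphic to $\bigoplus_{i=1}^N\mathcal{I}[b_i,d_i)$ (interval modules) with $N$ finite, $b_i$ finite and the intervals pairwise distinct. An $\epsilon$-morphism $\alpha:\mathcal{X}\to\mathcal{Y}$ is a family of linear maps $\alpha_h:X_h\to Y_{h+\epsilon}$ commuting with transition maps; an $\epsilon$-interleaving is a pair of $\epsilon$-morphisms $\alpha:\mathcal{X}\to\mathcal{Y}$, $\beta:\mathcal{Y}\to\mathcal{X}$ whose composites (both orders) are the transition maps shifting height by $2\epsilon$. Vineyard modules. A (1-Lipschitz) vineyard module over $[s_0,s_1]$ is a family of persistence modules $\{\mathcal{V}_t\}_{t\in[s_0,s_1]}$ with, for each $s<t$, a $|s-t|$-interleaving $\alpha^{s\to t}:\mathcal{V}_s\to\mathcal{V}_t$, $\beta^{t\to s}:\mathcal{V}_t\to\mathcal{V}_s$, such that all interleaving maps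 commute with each other and with the transition maps (any two composites with the same source time and height and the same target time and height agree). The underlying vineyard is the path of persistence diagrams of $\mathcal{V}_t$ (continuous for the bottleneck distance). A vine is such a path with at most one off-diagonal point at each time, whose support (the set of times with an off-diagonal point) is a nonempty interval. Since no diagram has points of multiplicity $\ge2$, the vineyard is uniquely a union of vines $\gamma_1,\dots,\gamma_N$; write $\gamma_i(t)=(\mathbf{b}(\gamma_i(t)),\mathbf{d}(\gamma_i(t)))$ for $t\in\operatorname{supp}(\gamma_i)$, and $S_t=\{i:t\in\operatorname{supp}(\gamma_i)\}$. A time is critical if the birth and death values in $\mathcal{V}_t$ are not all distinct, or a vine appears or disappears at that time. Standing assumptions: there are finitely many vines and finitely many critical times, and at each critical time at most one pair of critical heights (births/deaths) coincides. Segment. A vineyard module segment is the restriction of a vineyard module to a time interval $[T_m,T_{m+1}]$ with no critical times in $(T_m,T_{m+1})$ such that either neither endpoint is critical and $|T_m-T_{m+1}|\le\epsilon/4$ with $\epsilon$ the smallest distance between distinct birth and death values within time $T_m$ or within time $T_{m+1}$, or exactly one endpoint is critical and $|T_m-T_{m+1}|\le\epsilon/4$ with $\epsilon$ the smallest distance between distinct birth and death values at that critical endpoint (if a vine appears or disappears there, its limiting value counts as one of these values). Bases. For $x\in X_h$, $\mathbf{b}(x)=h$ if $x$ is not in the image of $\phi_g^h$ for any $g<h$; then $\mathbf{d}(x)=\inf\{g>\mathbf{b}(x):\phi_{\mathbf{b}(x)}^g(x)=0\}$. A basis of $\mathcal{X}\cong\bigoplus_i\mathcal{I}[b_i,d_i)$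 is a set $\{x_i\}$ with $x_i\in X_{b_i}$, $\mathbf{b}(x_i)=b_i$, $\mathbf{d}(x_i)=d_i$, such that for each $h$ the set $\{\phi_{b_i}^h(x_i):b_i\le h<d_i\}$ is a basis of $X_h$. An extended basis is a basis together with an indexed set of zero elements. Extended bases $B_t=\{x_1^t,\dots,x_N^t\}$ of $\mathcal{V}_t$ are indexed by the vines: $x_i^t$ has birth $\mathbf{b}(\gamma_i(t))$ and death $\mathbf{d}(\gamma_i(t))$ if $t\in\operatorname{supp}(\gamma_i)$, and $x_i^t=0$ otherwise. For an $\epsilon$-morphism $\alpha:\mathcal{X}\to\mathcal{Y}$ and bases $B_X=\{x_i\}$, $B_Y=\{y_j\}$, the matrix $\mathrm{Mat}_{B_X}^{B_Y}(\alpha)$ is defined by $\alpha(x_i)=\sum_j\mathrm{Mat}_{B_X}^{B_Y}(\alpha)(j,i)\,\psi_{\mathbf{b}(y_j)}^{\mathbf{b}(x_i)+\epsilon}(y_j)$, summing over $j$ with $\mathbf{b}(y_j)\le\mathbf{b}(x_i)+\epsilon<\mathbf{d}(y_j)$ ($\psi$ the transition maps of $\mathcal{Y}$), all other entries being $0$; rows and columns of zero elements of extended bases are zero. For a matrix $A=(a_{ji})$ and (extended) basis $B=\{x_i\}$, $A(B)$ is the set with $i$-th element $\sum_ja_{ji}\phi_{\mathbf{b}(x_j)}^{\mathbf{b}(x_i)}(x_j)$. $\pi_S$ is the diagonal matrix with $1$ at indices in $S$ and $0$ otherwise; for $k\ne l$, $e_{lk}^\mu$ is the identity matrix with an additional entry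 $\mu$ in position (row $l$, column $k$). Compatibility. Write $\gamma_l(t)\le\gamma_k(t)$ if $\mathbf{b}(\gamma_l(t))\le\mathbf{b}(\gamma_k(t))$ and $\mathbf{d}(\gamma_l(t))\le\mathbf{d}(\gamma_k(t))$. Time $s$ is forwards incompatible by $(\gamma_k,\gamma_l)$ if $\gamma_l(s)\le\gamma_k(s)$ but $\gamma_l(t)\not\le\gamma_k(t)$ for all $t\in(s,s+\delta)$ with $\delta>0$ sufficiently small; otherwise $s$ is forwards compatible. Forwards simplified. Given $\{B_t^{old}\}$, let $A=\mathrm{Mat}_{B^{new}_{T_m}}^{B^{old}_{T_{m+1}}}(\alpha^{T_m\to T_{m+1}})$ where $B^{new}_{T_m}=B^{old}_{T_m}$, and let $\tilde A$ be $A$ with $1$ added to each zero diagonal entry. A family $\{B_t^{new}\}$ of extended bases is forwards simplified if (i) when $T_m$ is forwards compatible: $B^{new}_{T_m}=B^{old}_{T_m}$, $B^{new}_{T_{m+1}}=\tilde A(B^{old}_{T_{m+1}})$, and $\mathrm{Mat}_{B^{new}_s}^{B^{new}_t}(\alpha^{s\to t})=\pi_{S_s\cap S_t}$ for all $s<t$ sufficiently close; (ii) when $T_m$ is forwards incompatible by $(\gamma_k,\gamma_l)$, with $\lambda=A(l,k)/A(l,l)$: $B^{new}_{T_m}=B^{old}_{T_m}$, $B^{new}_{T_{m+1}}=(Ae_{lk}^{-\lambda})(B^{old}_{T_{m+1}})$, $\mathrm{Mat}_{B^{new}_s}^{B^{new}_t}(\alpha^{s\to t})=\pi_{S_s\cap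 S_t}$ for all $T_m<s<t$ with $s,t$ sufficiently close, and $\mathrm{Mat}_{B^{new}_{T_m}}^{B^{new}_t}(\alpha^{T_m\to t})=e_{lk}^\lambda\pi_{S_{T_m}}$ for all $t>T_m$ sufficiently close. Here ''sufficiently close'' means: for each time $u\in[T_m,T_{m+1}]$ there is $\delta_u>0$ such that the identity holds for all admissible $s<t$ in $[T_m,T_{m+1}]$ with $u\in\{s,t\}$ and $|s-t|<\delta_u$. *)

(* Defs.v *)
From HB Require Import structures.
From mathcomp Require Import all_boot all_order all_algebra finmap.
From mathcomp Require Import boolp classical_sets functions cardinality reals.
From mathcomp Require Import constructive_ereal ereal topology normedtype.

Set Implicit Arguments.
Unset Strict Implicit.
Unset Printing Implicit Defensive.

Import Order.TTheory GRing.Theory Num.Theory.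
Import numFieldNormedType.Exports.

Local Open Scope classical_set_scope.
Local Open Scope ring_scope.

(* Transition maps, and below the interleaving maps, are total functions of
   their heights (times); they are constrained only in the meaningful range.
   The spaces are finite-dimensional since only modules isomorphic to finite
   sums of interval modules are considered. *)
Record persmod (F : fieldType) (R : realType) := PersMod {
  space :> R -> vectType F;
  phi : forall g h : R, 'Hom(space g, space h);
  phi_id : forall h, phi h h = \1%VF;
  phi_comp : forall f g h, f <= g -> g <= h ->
    (phi g h \o phi f g)%VF = phi f h }.

Arguments phi {F R X} g h : rename.

Definition persmod_iso (F : fieldType) (R : realType) (X Y : persmod F R) :=
  exists f : forall h : R, 'Hom(X h, Y h),
    (forall h, bijective (f h)) /\
    (forall g h, g <= h -> (f h \o phi g h)%VF = (phi g h \o f g)%VF).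

(* The point (b, d) stands for the interval [b, d); d may be +oo. *)
Definition point (R : realType) : Type := (R * \bar R)%type.
HB.instance Definition _ (R : realType) := Choice.on (point R).

Section IntervalSum.
Variables (F : fieldType) (R : realType) (D : {fset point R}).

Definition bars_at (h : R) : {fset point R} :=
  [fset p in D | (p.1 <= h) && (h%:E < p.2)%E]%fset.

Definition interval_sum_space (h : R) : vectType F := {ffun bars_at h -> F^o}.

Definition interval_sum_fun (g h : R) (v : interval_sum_space g) :
    interval_sum_space h :=
  [ffun p : bars_at h =>
    oapp v 0 (insub (val p) : option (bars_at g))].

Fact interval_sum_fun_linear (g h : R) : linear (@interval_sum_fun g h).
Proof.
move=> a u v; apply/ffunP => p; rewrite !ffunE.
by case: insubP => [q _ _|_] /=; rewrite ?ffunE // scaler0 addr0.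
Qed.

HB.instance Definition _ (g h : R) := GRing.isLinear.Build F
  (interval_sum_space g) (interval_sum_space h) _
  (@interval_sum_fun g h) (@interval_sum_fun_linear g h).

Definition interval_sum_phi (g h : R) :
    'Hom(interval_sum_space g, interval_sum_space h) :=
  linfun (@interval_sum_fun g h).

Fact interval_sum_phi_id (h : R) : interval_sum_phi h h = \1%VF.
Proof.
apply/lfunP => v; rewrite lfunE id_lfunE; apply/ffunP => p.
by rewrite ffunE valK.
Qed.

Fact interval_sum_phi_comp (f g h : R) : f <= g -> g <= h ->
  (interval_sum_phi g h \o interval_sum_phi f g)%VF = interval_sum_phi f h.
Proof.
move=> fg gh; apply/lfunP => v; rewrite comp_lfunE !lfunE; apply/ffunP => p.
rewrite !ffunE; case: insubP => [q _ qp|pg] /=; first by rewrite ffunE qp.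
case: insubP => [q pf _|//] /=; exfalso; move/negP: pg; apply.
have := valP p; move: pf; rewrite !inE /=.
move=> /andP[pD /andP[bf _]] /andP[_ /andP[_ hd]].
by rewrite pD (le_trans bf fg) (le_lt_trans _ hd) // lee_fin.
Qed.

(* The direct sum of the interval modules I[b, d), (b, d) in D: at height h a
   vector has one coordinate for each interval of D containing h. *)
Definition interval_sum : persmod F R :=
  PersMod interval_sum_phi_id interval_sum_phi_comp.

End IntervalSum.

(* Since D is a set, the intervals are pairwise distinct. *)
Definition is_diagram (F : fieldType) (R : realType) (X : persmod F R)
    (D : {fset point R}) :=
  (forall p, p \in D -> (p.1%:E < p.2)%E) /\ persmod_iso X (interval_sum F D).

Section Interleaving.
Variables (F : fieldType) (R : realType).

Record eps_morphism (X Y : persmod F R) (e : R) := EpsMorphism {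
  emap :> forall h : R, 'Hom(X h, Y (h + e));
  emap_comm : forall g h, g <= h ->
    (emap h \o phi g h)%VF = (phi (g + e) (h + e) \o emap g)%VF }.

Definition interleaving (X Y : persmod F R) (e : R)
    (a : eps_morphism X Y e) (b : eps_morphism Y X e) :=
  (forall h, (b (h + e) \o a h)%VF = phi h (h + e + e)) /\
  (forall h, (a (h + e) \o b h)%VF = phi h (h + e + e)).

(* In alpha s t and beta s t one has s < t; beta s t maps V t to V s. *)
Inductive composite (s0 s1 : R) (V : R -> persmod F R)
    (alpha : forall s t : R, eps_morphism (V s) (V t) `|s - t|)
    (beta : forall s t : R, eps_morphism (V t) (V s) `|s - t|)
    (t0 h0 : R) : forall t h : R, 'Hom(V t0 h0, V t h) -> Prop :=
| composite_id : composite s0 s1 alpha beta (\1%VF : 'Hom(V t0 h0, V t0 h0))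
| composite_phi (t g h : R) (f : 'Hom(V t0 h0, V t g)) : g <= h ->
    composite s0 s1 alpha beta f ->
    composite s0 s1 alpha beta (phi g h \o f)%VF
| composite_alpha (s t h : R) (f : 'Hom(V t0 h0, V s h)) :
    s0 <= s -> s < t -> t <= s1 ->
    composite s0 s1 alpha beta f ->
    composite s0 s1 alpha beta (alpha s t h \o f)%VF
| composite_beta (s t h : R) (f : 'Hom(V t0 h0, V t h)) :
    s0 <= s -> s < t -> t <= s1 ->
    composite s0 s1 alpha beta f ->
    composite s0 s1 alpha beta (beta s t h \o f)%VF.

Record vineyard_module (s0 s1 : R) := VineyardModule {
  vmod :> R -> persmod F R;
  alpha : forall s t : R, eps_morphism (vmod s) (vmod t) `|s - t|;
  beta : forall s t : R, eps_morphism (vmod t) (vmod s) `|s - t|;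
  vineyard_interleaving : forall s t, s0 <= s -> s < t -> t <= s1 ->
    interleaving (alpha s t) (beta s t);
  vineyard_commute : forall (t0 h0 t h : R), s0 <= t0 <= s1 ->
    forall f f' : 'Hom(vmod t0 h0, vmod t h),
    composite s0 s1 alpha beta f -> composite s0 s1 alpha beta f' -> f = f' }.

End Interleaving.

Section Vines.
Variable R : realType.

Definition points_close (e : R) (p q : point R) :=
  [/\ `|p.1 - q.1| <= e, (p.2 <= q.2 + e%:E)%E & (q.2 <= p.2 + e%:E)%E].

Definition near_diagonal (e : R) (p : point R) := (p.2 <= (p.1 + 2 * e)%:E)%E.

(* A partial matching between D and D' of cost at most e. *)
Definition bottleneck_le (e : R) (D D' : {fset point R}) :=
  exists M : {fset point R * point R},
  [/\ forall m, m \in M ->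
        [/\ m.1 \in D, m.2 \in D' & points_close e m.1 m.2],
      forall m m', m \in M -> m' \in M -> (m.1 = m'.1 <-> m.2 = m'.2),
      forall p, p \in D ->
        (exists2 m, m \in M & m.1 = p) \/ near_diagonal e p
    & forall q, q \in D' ->
        (exists2 m, m \in M & m.2 = q) \/ near_diagonal e q].

Definition bottleneck_continuous (s0 s1 : R) (D : R -> {fset point R}) :=
  forall t, s0 <= t <= s1 -> forall e, 0 < e ->
  exists2 delta, 0 < delta &
    forall u, s0 <= u <= s1 -> `|u - t| < delta -> bottleneck_le e (D t) (D u).

Definition supp (gamma : R -> option (point R)) : set R := [set t | gamma t].

Definition vine_diagram (gamma : R -> option (point R)) (t : R) :
    {fset point R} :=
  if gamma t is Some p then [fset p]%fset else fset0.

Definition is_vine (s0 s1 : R) (gamma : R -> option (point R)) :=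
  [/\ supp gamma `<=` [set t | s0 <= t <= s1],
      supp gamma !=set0, is_interval (supp gamma),
      forall t p, gamma t = Some p -> (p.1%:E < p.2)%E
    & bottleneck_continuous s0 s1 (vine_diagram gamma)].

Variable N : nat.
Implicit Type gamma : 'I_N -> R -> option (point R).

Definition is_vineyard_of (F : fieldType) (s0 s1 : R)
    (V : vineyard_module F s0 s1) gamma :=
  [/\ forall i, is_vine s0 s1 (gamma i),
      forall t i j p, gamma i t = Some p -> gamma j t = Some p -> i = j
    & forall t, s0 <= t <= s1 -> exists2 D : {fset point R},
        is_diagram (V t) D &
        forall p, p \in D <-> exists i, gamma i t = Some p].

Definition S_ gamma (t : R) : {set 'I_N} := [set i | isSome (gamma i t)]%SET.

(* The support of a vine is relatively open in [s0, s1], hence a vine is absent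
   at the times at which it appears or disappears. *)
Definition appears (g : R -> option (point R)) (t : R) := ~ supp g t /\
  exists2 delta, 0 < delta & forall u, t < u < t + delta -> supp g u.

Definition disappears (g : R -> option (point R)) (t : R) := ~ supp g t /\
  exists2 delta, 0 < delta & forall u, t - delta < u < t -> supp g u.

Definition coordinate (p : point R) (is_death : bool) : \bar R :=
  if is_death then p.2 else p.1%:E.

(* Births and deaths are labelled by (i, false) and (i, true). Infinite deaths
   are not heights, and so are never among the values below. *)
Definition bd_value gamma (t : R) (k : 'I_N * bool) (v : R) :=
  exists2 p, gamma k.1 t = Some p & coordinate p k.2 = v%:E.

Definition limit_value gamma (t : R) (k : 'I_N * bool) (v : R) :=
  (appears (gamma k.1) t \/ disappears (gamma k.1) t) /\
  coordinate (odflt (0, 0%E) (gamma k.1 u)) k.2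
    @[u --> within (supp (gamma k.1)) (nbhs t)] --> v%:E.

Definition critical_height gamma (t : R) (k : 'I_N * bool) (v : R) :=
  bd_value gamma t k v \/ limit_value gamma t k v.

Definition critical gamma (t : R) :=
  (exists k k' v, [/\ k != k', bd_value gamma t k v & bd_value gamma t k' v]) \/
  (exists i, appears (gamma i) t \/ disappears (gamma i) t).

Definition coincide gamma (t : R) (k k' : 'I_N * bool) := k != k' /\
  exists2 v, critical_height gamma t k v & critical_height gamma t k' v.

Definition standing_assumptions gamma :=
  finite_set [set t | critical gamma t] /\
  forall t, critical gamma t -> forall k k' m m',
    coincide gamma t k k' -> coincide gamma t m m' ->
    (k = m /\ k' = m') \/ (k = m' /\ k' = m).

Definition min_gap gamma (t : R) : \bar R :=
  ereal_inf [set x | exists v w, [/\ v != w,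
    exists k, critical_height gamma t k v,
    exists k, critical_height gamma t k w & x = `|v - w|%:E]].

Definition is_segment (s0 s1 : R) gamma (a b : R) :=
  [/\ s0 <= a, a < b, b <= s1,
      forall t, a < t < b -> ~ critical gamma t
    & [\/ [/\ ~ critical gamma a, ~ critical gamma b &
             (`|a - b|%:E <=
                mine (min_gap gamma a) (min_gap gamma b) * 4^-1%:E)%E],
          [/\ critical gamma a, ~ critical gamma b &
             (`|a - b|%:E <= min_gap gamma a * 4^-1%:E)%E]
        | [/\ ~ critical gamma a, critical gamma b &
             (`|a - b|%:E <= min_gap gamma b * 4^-1%:E)%E]]].

Definition vine_le (g g' : R -> option (point R)) (t : R) :=
  exists p q, [/\ g t = Some p, g' t = Some q, p.1 <= q.1 & (p.2 <= q.2)%E].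

Definition forwards_incompatible_by gamma (s : R) (k l : 'I_N) :=
  vine_le (gamma l) (gamma k) s /\
  exists2 delta, 0 < delta &
    forall t, s < t < s + delta -> ~ vine_le (gamma l) (gamma k) t.

Definition forwards_compatible gamma (s : R) :=
  ~ exists k l, forwards_incompatible_by gamma s k l.

End Vines.

Section Bases.
Variables (F : fieldType) (R : realType) (N : nat).

Definition born (X : persmod F R) (h : R) (x : X h) :=
  forall g, g < h -> ~ exists y : X g, phi g h y = x.

(* +oo if x is never mapped to 0 *)
Definition death (X : persmod F R) (h : R) (x : X h) : \bar R :=
  ereal_inf [set g%:E | g in [set g | h < g /\ phi h g x = 0]].

(* An element is stored with its height, which is its birth in a basis; the
   zero elements of an extended basis, which have no birth, are None. *)
Definition ext_family (X : persmod F R) := 'I_N -> option {h : R & X h}.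

Definition alive (X : persmod F R) (x : {h : R & X h}) (h : R) :=
  (tag x <= h) && (h%:E < death (tagged x))%E.

Definition images_at (X : persmod F R) (B : ext_family X) (h : R) : seq (X h) :=
  pmap (fun i => if B i is Some x then
                   if alive x h then Some (phi (tag x) h (tagged x)) else None
                 else None) (enum 'I_N).

Definition is_ext_basis (X : persmod F R) (P : 'I_N -> option (point R))
    (B : ext_family X) :=
  (forall i, match P i, B i with
             | Some p, Some x =>
                 [/\ tag x = p.1, born (tagged x) & death (tagged x) = p.2]
             | None, None => True
             | _, _ => False
             end) /\
  (forall h, basis_of {: X h} (images_at B h)).

Definition contributes (X Y : persmod F R) (e : R)
    (x : option {h : R & X h}) (y : option {h : R & Y h}) : bool :=
  if x is Some x' then if y is Some y' then alive y' (tag x' + e) else false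
  else false.

Definition represents (X Y : persmod F R) (e : R) (BX : ext_family X)
    (BY : ext_family Y) (a : eps_morphism X Y e) (M : 'M[F]_N) :=
  (forall j i, ~~ contributes e (BX i) (BY j) -> M j i = 0) /\
  (forall i x, BX i = Some x ->
     a (tag x) (tagged x) =
     \sum_(j < N | contributes e (BX i) (BY j))
        M j i *: (if BY j is Some y
                  then phi (tag y) (tag x + e) (tagged y) else 0)).

(* The representing matrix exists and is unique when BX, BY are extended
   bases. *)
Definition Mat (X Y : persmod F R) (e : R) (BX : ext_family X)
    (BY : ext_family Y) (a : eps_morphism X Y e) : 'M[F]_N :=
  xget 0 [set M | represents BX BY a M].

Definition mx_act (X : persmod F R) (A : 'M[F]_N) (B : ext_family X) :
    ext_family X := fun i =>
  if B i is Some x then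
    Some (Tagged (fun h : R => X h : Type)
      (\sum_(j < N) A j i *: (if B j is Some y
         then phi (tag y) (tag x) (tagged y) else 0)))
  else None.

Definition pi_mx (S : {set 'I_N}) : 'M[F]_N := diag_mx (\row_i (i \in S)%:R).

Definition e_mx (l k : 'I_N) (mu : F) : 'M[F]_N := 1%:M + mu *: delta_mx l k.

Definition fill_diag (A : 'M[F]_N) : 'M[F]_N :=
  \matrix_(i, j) (A i j + ((i == j) && (A i j == 0))%:R).

Definition for_close (a b : R) (P : R -> R -> Prop) :=
  forall u, a <= u <= b -> exists2 delta, 0 < delta &
    forall s t, a <= s -> s < t -> t <= b -> u = s \/ u = t ->
      `|s - t| < delta -> P s t.

Variables (s0 s1 : R) (V : vineyard_module F s0 s1).
Variable gamma : 'I_N -> R -> option (point R).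

Definition ext_bases (a b : R) (B : forall t : R, ext_family (V t)) :=
  forall t, a <= t <= b -> is_ext_basis (gamma ^~ t) (B t).

Definition forwards_simplified (a b : R)
    (Bold Bnew : forall t : R, ext_family (V t)) :=
  let A := Mat (Bnew a) (Bold b) (alpha V a b) in
  (forwards_compatible gamma a ->
     [/\ Bnew a = Bold a,
         Bnew b = mx_act (fill_diag A) (Bold b)
       & for_close a b (fun s t =>
           Mat (Bnew s) (Bnew t) (alpha V s t) =
           pi_mx (S_ gamma s :&: S_ gamma t))]) /\
  (forall k l, forwards_incompatible_by gamma a k l ->
     let lambda := A l k / A l l in
     [/\ Bnew a = Bold a,
         Bnew b = mx_act (A *m e_mx l k (- lambda)) (Bold b),
         for_close a b (fun s t => a < s ->
           Mat (Bnew s) (Bnew t) (alpha V s t) =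
           pi_mx (S_ gamma s :&: S_ gamma t))
       & for_close a b (fun s t => s = a ->
           Mat (Bnew s) (Bnew t) (alpha V s t) =
           e_mx l k lambda *m pi_mx (S_ gamma a))]).

End Bases.

(* Main.v *)
(* Births and deaths move at speed at most 1, so the gap condition forces the
   entry (j, i) of the matrix of an interleaving map between two times of the
   segment to vanish unless gamma_j <= gamma_i at the critical endpoint, while
   the diagonal entries are nonzero because a round trip is a transition map.
   The matrix A is thus triangular.  If the order of the vines persists after
   T_m, then A(B_old) is again a basis at T_{m+1}; otherwise exactly one pair of
   vines is reversed, and e_lk^{-lambda} cancels the offending entry.
   Nearby modules at regular times are identified up to elements that die long
   after the births concerned, so a basis at one time propagates coherently over
   any interval of regular times: backwards from T_{m+1} if T_{m+1} is regular,
   forwards from T_m otherwise.  The matrices at the remaining endpoint are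
   computed after pushing to the far end of the segment, which loses nothing
   since by the gap condition the same vines contribute at all times. *)

From mathcomp Require Import all_boot all_order all_algebra finmap.
From mathcomp Require Import boolp classical_sets reals constructive_ereal ereal.
From mathcomp Require Import topology normedtype ring lra.
Require Import Defs.

Set Implicit Arguments.
Unset Strict Implicit.
Unset Printing Implicit Defensive.

Import Order.TTheory GRing.Theory Num.Theory.
Import numFieldNormedType.Exports.

Local Open Scope classical_set_scope.
Local Open Scope ring_scope.

(** * Bases of persistence modules *)

(** Three points shape the argument. The diagrams are only assumed to vary continuously for the
    bottleneck distance, so the speed bound on each vine has to be extracted from the interleavings:
    a round trip between close regular times returns to a long bar only through a bar close to it. A
    critical endpoint has no point for a vine that appears or disappears there; a diagonal point is
    added for it, so that every comparison in the segment is made with one completed diagram, whose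
    distinct values are at least four times the length of the segment apart, while a round trip
    costs at most twice that length. Finally, bases at different times live in different types, and
    there are uncountably many times. Candidates are therefore encoded as matrices acting on the
    given bases, and local families are chained by compactness; as the regular times form a
    half-open interval, a sequence of closed intervals exhausts it, each extension leaving earlier
    choices unchanged. *)

Section FreeFamilies.
Variables (K : fieldType) (V : vectType K) (I : eqType).
Implicit Types (r : seq I) (f : I -> V) (c : I -> K).

Lemma span_mapP r f v : uniq r -> v \in <<map f r>>%VS ->
  exists c, v = \sum_(i <- r) c i *: f i.
Proof.
elim: r v => [|i r IH] v /=.
  by rewrite span_nil memv0 => _ /eqP ->; exists (fun=> 0); rewrite big_nil.
move=> /andP[ir ur]; rewrite span_cons => /memv_addP[_ /vlineP[a ->]] [w wr ->].
have [c ->] := IH w ur wr.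
exists (fun j => if j == i then a else c j); rewrite big_cons eqxx.
congr (_ + _); apply: eq_big_seq => j jr; case: eqP => // ji.
by rewrite -ji jr in ir.
Qed.

Lemma free_mapP r f : uniq r ->
  free (map f r) <-> (forall c, \sum_(i <- r) c i *: f i = 0 ->
                      forall i, i \in r -> c i = 0).
Proof.
elim: r => [|i r IH] /= ur; first by split; rewrite ?nil_free.
move: ur => /andP[ir ur].
have nir j : j \in r -> (j == i) = false.
  by move=> jr; apply/eqP => ji; rewrite -ji jr in ir.
rewrite free_cons; split.
  move=> /andP[fi fr] c; rewrite big_cons => s0.
  have ci : c i = 0.
    apply/eqP; apply: contraT => ci; case/negP: fi.
    have -> : f i = - (c i)^-1 *: \sum_(j <- r) c j *: f j.
      have -> : \sum_(j <- r) c j *: f j = - (c i *: f i).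
        by apply/eqP; rewrite -addr_eq0 addrC s0.
      by rewrite scalerN scaleNr opprK scalerA mulVf // scale1r.
    apply: memvZ; rewrite big_seq; apply: memv_suml => j jr; apply: memvZ.
    by rewrite memv_span // map_f.
  move: s0; rewrite ci scale0r add0r => s0 j; rewrite inE => /orP[/eqP -> //|].
  exact: (proj1 (IH ur) fr c s0 j).
move=> H; apply/andP; split.
  apply/negP => /(span_mapP ur)[c fE].
  pose c' j := if j == i then 1 else - c j.
  have /H/(_ i (mem_head _ _)) : \sum_(j <- i :: r) c' j *: f j = 0.
    rewrite big_cons /c' eqxx scale1r fE -big_split /= big1_seq // => j /= jr.
    by rewrite nir // scaleNr subrr.
  by rewrite /c' eqxx => /eqP; rewrite oner_eq0.
apply/(IH ur) => c s0 j jr.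
pose c' j := if j == i then 0 else c j.
have /(_ _ j) := H c'; rewrite /c' (nir j jr); apply; last by rewrite inE jr orbT.
rewrite big_cons eqxx scale0r add0r -[RHS]s0; apply: eq_big_seq => k kr.
by rewrite nir.
Qed.

End FreeFamilies.

Section Algebra.
Variables (F : fieldType) (R : realType) (N : nat).
Implicit Types (X Y : persmod F R).

(** The value is 0 for a missing element and below the height of the element, so that sums can run
    over all indices at every height. For a basis it is also 0 from the death on, by
    [elt_notalive]. *)
Definition elt (X : persmod F R) (x : option {h : R & X h}) (h : R) : X h :=
  if x is Some y then
    if tag y <= h then phi (tag y) h (tagged y) else 0 else 0.

Definition alv (p : option (point R)) (h : R) : bool :=
  if p is Some p then (p.1 <= h) && (h%:E < p.2)%E else false.

Definition proper (P : 'I_N -> option (point R)) :=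
  forall i p, P i = Some p -> (p.1%:E < p.2)%E.

Definition simple (P : 'I_N -> option (point R)) :=
  forall i j p, P i = Some p -> P j = Some p -> i = j.

Definition ple (p q : point R) := (p.1 <= q.1) && (p.2 <= q.2)%E.

Lemma phi_comp_app X f g h (v : X f) : f <= g -> g <= h ->
  phi g h (phi f g v) = phi f h v.
Proof. by move=> fg gh; rewrite -(phi_comp X fg gh) comp_lfunE. Qed.

Lemma phi_id_app X h (v : X h) : phi h h v = v.
Proof. by rewrite phi_id id_lfunE. Qed.

Lemma phi_elt X (x : option {h : R & X h}) g h : g <= h ->
  (if x is Some y then tag y <= g else true) ->
  phi g h (elt x g) = elt x h.
Proof.
case: x => [y|] gh /=; last by rewrite linear0.
by move=> yg; rewrite yg (le_trans yg gh) phi_comp_app.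
Qed.

Lemma elt_delta X (B : ext_family N X) i h :
  elt (B i) h = \sum_(j < N) (j == i)%:R *: elt (B j) h.
Proof.
rewrite (bigD1 i) //= eqxx scale1r big1 ?addr0 // => j /negbTE ->.
by rewrite scale0r.
Qed.

Section Basis.
Variables (X : persmod F R) (P : 'I_N -> option (point R)) (B : ext_family N X).
Hypothesis BP : is_ext_basis P B.

Lemma ext_basis_Some i p : P i = Some p -> exists2 y : X p.1,
  B i = Some (existT (fun h => X h : Type) p.1 y) & born y /\ death y = p.2.
Proof.
move=> Pi; have := BP.1 i; rewrite Pi; case: (B i) => // -[h y] /= [hp].
by case: _ / hp y => y by_ dy; exists y.
Qed.

Lemma ext_basis_None i : P i = None -> B i = None.
Proof. by move=> Pi; have := BP.1 i; rewrite Pi; case: (B i). Qed.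

Lemma ext_basis_point i x : B i = Some x -> exists2 p, P i = Some p &
  [/\ tag x = p.1, born (tagged x) & death (tagged x) = p.2].
Proof.
by move=> Bi; have := BP.1 i; rewrite Bi; case: (P i) => // p Hx; exists p.
Qed.

Lemma alive_alv i x h : B i = Some x -> alive x h = alv (P i) h.
Proof. by move=> /ext_basis_point[p -> [tx _ dx]]; rewrite /alive /= dx tx. Qed.

End Basis.

Lemma images_atE X P (B : ext_family N X) h :
  (forall i x, B i = Some x -> alive x h = alv (P i) h) ->
  (forall i, B i = None -> P i = None) ->
  images_at B h = [seq elt (B i) h | i <- enum 'I_N & alv (P i) h].
Proof.
move=> HS HN; rewrite /images_at; elim: (enum _) => //= i r IH.
case Bi: (B i) => [x|] /=; last by rewrite (HN i Bi) /= IH.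
rewrite (HS i x Bi); case: ifP => //= a; rewrite IH; congr (_ :: _).
have /andP[xh _] : alive x h by rewrite (HS i x Bi).
by rewrite Bi /= xh.
Qed.

Lemma images_at_basis X P (B : ext_family N X) h : is_ext_basis P B ->
  images_at B h = [seq elt (B i) h | i <- enum 'I_N & alv (P i) h].
Proof.
move=> BP; apply: images_atE => [i x|i Bi]; first exact: alive_alv.
by have := BP.1 i; rewrite Bi; case: (P i).
Qed.

Lemma sum_filter (M : zmodType) (a : pred 'I_N) (f : 'I_N -> M) :
  \sum_(i <- enum 'I_N | a i) f i = \sum_(i < N | a i) f i.
Proof. by rewrite big_enum_cond. Qed.

Section Expand.
Variables (X : persmod F R) (P : 'I_N -> option (point R)) (B : ext_family N X).
Hypothesis BP : is_ext_basis P B.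

(** Coefficients are functions on all indices, supported on the vines alive at h; expansions at
    different heights, times or bases are then compared index by index. *)
Lemma expand h (v : X h) : exists2 c : 'I_N -> F,
  forall i, c i != 0 -> alv (P i) h & v = \sum_(i < N) c i *: elt (B i) h.
Proof.
have := BP.2 h; rewrite (images_at_basis h BP) => /andP[/eqP sp _].
have : v \in <<[seq elt (B i) h | i <- enum 'I_N & alv (P i) h]>>%VS.
  by rewrite sp memvf.
move=> /span_mapP[|c ->]; first by rewrite filter_uniq ?enum_uniq.
exists (fun i => if alv (P i) h then c i else 0).
  by move=> i; case: ifP; rewrite ?eqxx.
rewrite big_filter sum_filter big_mkcond; apply: eq_bigr => i _.
by case: ifP => // _; rewrite scale0r.
Qed.

Lemma expand0 h (c : 'I_N -> F) : (forall i, c i != 0 -> alv (P i) h) ->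
  \sum_(i < N) c i *: elt (B i) h = 0 -> forall i, c i = 0.
Proof.
move=> Hc s0 i; case: (eqVneq (c i) 0) => // /Hc ai.
have := BP.2 h; rewrite (images_at_basis h BP) => /andP[_].
move=> /(proj1 (free_mapP _ (filter_uniq _ (enum_uniq _)))) /(_ c); apply.
  rewrite big_filter sum_filter -[RHS]s0 big_mkcond; apply: eq_bigr => j _.
  case: ifPn => // nj; case: (eqVneq (c j) 0) => [->|/Hc];
  by rewrite ?scale0r ?(negbTE nj).
by rewrite mem_filter ai mem_enum.
Qed.

Lemma expand_inj h (c c' : 'I_N -> F) :
  (forall i, c i != 0 -> alv (P i) h) -> (forall i, c' i != 0 -> alv (P i) h) ->
  \sum_(i < N) c i *: elt (B i) h = \sum_(i < N) c' i *: elt (B i) h ->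
  forall i, c i = c' i.
Proof.
move=> Hc Hc' /eqP; rewrite -subr_eq0 -sumrB => /eqP s0 i; apply/eqP.
rewrite -subr_eq0; apply/eqP; apply: (@expand0 h (fun i => c i - c' i)) => [j|].
  by case: (eqVneq (c j) 0) => [-> |/Hc //]; rewrite sub0r oppr_eq0 => /Hc'.
by rewrite -[RHS]s0; apply: eq_bigr => j _; rewrite scalerBl.
Qed.

Lemma elt_phi g h i p : P i = Some p -> p.1 <= g -> g <= h ->
  phi g h (elt (B i) g) = elt (B i) h.
Proof.
move=> Pi pg gh; apply: phi_elt => //.
by have [x ->] := ext_basis_Some BP Pi.
Qed.

Lemma elt_None h i : P i = None -> elt (B i) h = 0.
Proof. by move=> Pi; rewrite (ext_basis_None BP Pi). Qed.

(** The death is only an infimum, so vanishing at the death itself has to be proved. It follows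
    because an element that vanishes just after h, before any other element alive at h dies, has no
    nonzero coefficient at h. *)
Lemma elt_notalive h i : ~~ alv (P i) h -> elt (B i) h = 0.
Proof.
case Pi: (P i) => [p|] /=; last by move=> _; exact: elt_None.
have [x Bi [_ dx]] := ext_basis_Some BP Pi.
rewrite Bi /=; case: ifP => //= ph; rewrite -leNgt => dh.
have [c Hc Ec] := expand (phi p.1 h (elt (B i) p.1)).
(* The deaths after h, with default [+oo]. Their minimum exceeds h, hence exceeds the death of x,
   and some g below it already kills x. *)
pose later j : \bar R :=
  if P j is Some q then if (h%:E < q.2)%E then q.2 else +oo%E else +oo%E.
have lt_m : (h%:E < \big[Order.min/+oo]_(j < N) later j)%E.
  apply: (big_ind (fun u => h%:E < u)%E) => [||j _]; first by rewrite ltry.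
    by move=> u v hu hv; rewrite lt_min hu hv.
  by rewrite /later; case: (P j) => [q|]; rewrite ?ltry //; case: ifP; rewrite ?ltry.
have [_ [g [/= bg g0] <-] gm] : exists2 y,
    [set g%:E | g in [set g | p.1 < g /\ phi p.1 g x = 0]] y &
    (y < \big[Order.min/+oo]_(j < N) later j)%E.
  by apply/ereal_inf_lt; rewrite -/(death x) dx; exact: le_lt_trans lt_m.
have eltx : elt (B i) p.1 = x by rewrite Bi /= lexx phi_id_app.
have [gh|hg] := leP g h.
  by rewrite -(phi_comp_app _ (ltW bg) gh) g0 linear0.
have pg : p.1 <= g by rewrite (le_trans ph) ?ltW.
have : phi h g (phi p.1 h (elt (B i) p.1)) = 0.
  by rewrite eltx phi_comp_app // ltW.
rewrite Ec linear_sum.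
under eq_bigr => j _ do rewrite linearZ /=.
have stay j : c j != 0 -> alv (P j) g && (phi h g (elt (B j) h) == elt (B j) g).
  move=> /Hc; case Pj: (P j) => [q|] //= /andP[qh hq].
  rewrite (elt_phi Pj qh (ltW hg)) eqxx (le_trans qh (ltW hg)) /= andbT.
  apply: (lt_le_trans gm); apply: le_trans (bigmin_le _ j _) _.
  by rewrite /later Pj hq.
under eq_bigr => j _.
  have -> : c j *: phi h g (elt (B j) h) = c j *: elt (B j) g.
    by case: (eqVneq (c j) 0) => [->|/stay/andP[_ /eqP ->]]; rewrite ?scale0r.
over.
move=> /expand0 c0; have : phi p.1 h (elt (B i) p.1) = 0.
  rewrite Ec big1 // => j _; rewrite c0 ?scale0r // => k /stay /andP[] //.
by rewrite eltx.
Qed.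

End Expand.

Lemma deathE X h (x : X h) d : (h%:E < d)%E ->
  (forall g, h < g -> phi h g x = 0 <-> (d <= g%:E)%E) -> death x = d.
Proof.
move=> hd H; apply/eqP; rewrite eq_le; apply/andP; split; last first.
  by apply: le_ereal_inf_tmp => _ [g /= [hg /(H _ hg) ?] <-].
case: d hd H => [d| |] //= hd H; last by rewrite leey.
apply: ereal_inf_lbound; exists d => //=; rewrite lte_fin in hd.
by split => //; apply/(H _ hd).
Qed.

(** * Triangular changes of basis *)

Section Triangular.
Variables (X : persmod F R) (P : 'I_N -> option (point R)) (B : ext_family N X).
Hypotheses (BP : is_ext_basis P B) (Pproper : proper P) (Psimple : simple P).
Variable C : 'M[F]_N.
Hypothesis Ctri : forall i j p q, P i = Some p -> P j = Some q -> C j i != 0 ->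
  ple q p.
Hypothesis Cdiag : forall i, P i -> C i i != 0.

(** Transition maps compose only along increasing heights; triangularity ensures that every term
    with a nonzero coefficient is born no later than p.1. *)
Lemma elt_mx_act i p h : P i = Some p -> p.1 <= h ->
  elt (mx_act C B i) h = \sum_(j < N) C j i *: elt (B j) h.
Proof.
move=> Pi ph; have [x Bi _] := ext_basis_Some BP Pi.
rewrite /mx_act Bi /= ph linear_sum /=; apply: eq_bigr => j _.
rewrite linearZ /=; case Pj: (P j) => [q|]; last first.
  by rewrite (ext_basis_None BP Pj) linear0 !scaler0.
have [y Bj _] := ext_basis_Some BP Pj; rewrite Bj /=.
have [->|Cji] := eqVneq (C j i) 0; first by rewrite !scale0r.
have /andP[qp _] := Ctri Pi Pj Cji.
by rewrite (le_trans qp ph) phi_comp_app.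
Qed.

(** Among the indices with nonzero coefficient, take m with the most vines below it. A nonzero C m i
    with i != m puts m strictly below i, so c i = 0 by maximality, and row m reduces to C m m * c
    m. *)
Lemma tri_free (c : 'I_N -> F) h : (forall i, c i != 0 -> alv (P i) h) ->
  (forall j, alv (P j) h -> \sum_(i < N) C j i * c i = 0) ->
  forall i, c i = 0.
Proof.
move=> Hc H i0; apply/eqP; apply: contraT => ci0.
pose le i j := if P i is Some p then if P j is Some q then ple p q else false
               else false.
pose rk i := #|[set j | le j i]%SET|.
pose m := [arg max_(i > i0 | (c i != 0)%R) rk i]%N.
have [cm mmax] : c m != 0 /\ forall j, c j != 0 -> (rk j <= rk m)%N.
  by rewrite /m; case: arg_maxnP => // j cj Hj; split => //.
have am := Hc _ cm; have := H m am.
rewrite (bigD1 m) //= big1 ?addr0 => [|i im].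
  move/eqP; rewrite mulf_eq0 (negbTE cm) orbF => /eqP C0.
  by have := @Cdiag m; rewrite C0 eqxx; case: (P m) am => // p _ /(_ isT).
have [->|Cmi] := eqVneq (C m i) 0; first by rewrite mul0r.
have [->|ci] := eqVneq (c i) 0; first by rewrite mulr0.
have := mmax i ci; rewrite leqNgt => /negP[].
apply: proper_card; have := Hc _ ci.
case Pi: (P i) => [p|] // _; move: am; case Pm: (P m) => [q|] // _.
have qp := Ctri Pi Pm Cmi; apply/properP; split.
  apply/fintype.subsetP => j; rewrite !inE /le; case: (P j) => [r|] //; rewrite Pi Pm.
  move: qp => /andP[q1 q2] /andP[r1 r2].
  by rewrite /ple (le_trans r1 q1) (le_trans r2 q2).
exists i; rewrite !inE /le Pi ?Pm; first by rewrite /ple !lexx.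
move: qp => /andP[q1 q2]; apply/negP => /andP[p1 p2].
have pq : p = q.
  case: p q p1 p2 q1 q2 {Pi Pm Cmi} => [p1 p2] [q1 q2] /= *.
  by congr (_, _); apply/le_anti/andP.
by rewrite (Psimple Pi (j := m)) ?eqxx // ?pq // in im.
Qed.

Lemma elt_mx_act_alive i p h : P i = Some p -> p.1 <= h ->
  elt (mx_act C B i) h =
  \sum_(j < N) (if alv (P j) h then C j i else 0) *: elt (B j) h.
Proof.
move=> Pi ph; rewrite (elt_mx_act Pi ph); apply: eq_bigr => j _.
by case: ifPn => // nj; rewrite (elt_notalive BP nj) !scaler0.
Qed.

Lemma mx_act_birth i p : P i = Some p -> exists y : X p.1,
  mx_act C B i = Some (existT (fun h => X h : Type) p.1 y).
Proof.
move=> Pi; have [x Bi _] := ext_basis_Some BP Pi.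
by rewrite /mx_act Bi; eexists; reflexivity.
Qed.

Lemma mx_act_None i : P i = None -> mx_act C B i = None.
Proof. by move=> Pi; rewrite /mx_act (ext_basis_None BP Pi). Qed.

Lemma mx_act_eq0 i p h : P i = Some p -> p.1 <= h ->
  elt (mx_act C B i) h = 0 <-> (p.2 <= h%:E)%E.
Proof.
move=> Pi ph; split; last first.
  move=> dh; rewrite (elt_mx_act_alive Pi ph) big1 // => j _.
  case: ifPn => [aj|_]; last by rewrite scale0r.
  have [->|Cji] := eqVneq (C j i) 0; first by rewrite scale0r.
  move: aj; case Pj: (P j) => [q|] //= /andP[_ hq].
  have /andP[_ qp] := Ctri Pi Pj Cji.
  by move: (lt_le_trans hq (le_trans qp dh)); rewrite ltxx.
rewrite (elt_mx_act_alive Pi ph) => s0; rewrite leNgt; apply/negP => hp.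
have ai : alv (P i) h by rewrite Pi /= ph.
have := expand0 BP _ s0 i; rewrite ai => /(_ _)/eqP.
rewrite (negbTE (Cdiag _)); last by rewrite Pi.
by move=> H; apply: notF; apply: H => j; case: ifP; rewrite ?eqxx.
Qed.

(** The coefficient C i i of the i-th new element is nonzero, so the element is not an image from
    below p.1 and survives until p.2; its other terms are dead by p.2. At each height the number of
    elements is that of the old basis, so freeness suffices. *)
Lemma tri_ext_basis : is_ext_basis P (mx_act C B).
Proof.
have birth i p : P i = Some p -> exists2 y : X p.1,
  mx_act C B i = Some (existT (fun h => X h : Type) p.1 y) &
  born y /\ death y = p.2.
  move=> Pi; have [x Bi'] := mx_act_birth Pi; exists x => //.
  have xE h : p.1 <= h -> elt (mx_act C B i) h = phi p.1 h x.
    by rewrite Bi' /= => ->.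
  split.
    move=> g gp [y yx].
    have [c Hc yE] := expand BP y.
    have: elt (mx_act C B i) p.1 = \sum_(j < N) (if alv (P j) p.1 then c j else 0)
        *: elt (B j) p.1.
      rewrite xE // phi_id_app -yx yE linear_sum; apply: eq_bigr => j _.
      rewrite linearZ /=.
      have [c0|cj] := eqVneq (c j) 0.
        by rewrite c0; case: ifP; rewrite !scale0r.
      have := Hc _ cj; case Pj: (P j) => [q|] //= /andP[qg _].
      rewrite (elt_phi BP Pj qg (ltW gp)); case: ifPn => // nj.
      by rewrite (elt_notalive BP (h := p.1)) ?scaler0 ?Pj.
    rewrite (elt_mx_act_alive Pi (lexx _)) => E.
    have ai : alv (P i) p.1 by rewrite Pi /= lexx /= (Pproper Pi).
    have := expand_inj BP _ _ E i; rewrite ai => /(_ _ _)/eqP.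
    have ci : c i = 0.
      apply/eqP; apply: contraT => /Hc; rewrite Pi /= => /andP[].
      by rewrite leNgt gp.
    rewrite ci (negbTE (Cdiag _)) ?Pi // => H; apply: notF; apply: H => j;
    by case: ifP; rewrite ?eqxx.
  apply: deathE => [|g pg]; first exact: Pproper Pi.
  by rewrite -(xE _ (ltW pg)); apply: mx_act_eq0 => //; exact: ltW.
split=> [i|h].
  case Pi: (P i) => [p|]; last by rewrite mx_act_None.
  by have [x -> []] := birth i p Pi.
have HS i x : mx_act C B i = Some x -> alive x h = alv (P i) h.
  case Pi: (P i) => [p|]; last by rewrite mx_act_None.
  have [y -> [_ dy]] := birth i p Pi => -[<-].
  by rewrite /alive /= dy.
have HN i : mx_act C B i = None -> P i = None.
  by case Pi: (P i) => [p|] //; have [y ->] := birth i p Pi.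
rewrite (images_atE HS HN) basisEfree subvf /=.
have := BP.2 h; rewrite (images_at_basis h BP) basisEfree => /and3P[_ _].
rewrite !size_map => ->; rewrite andbT.
apply/free_mapP => [|c]; first by rewrite filter_uniq ?enum_uniq.
rewrite big_filter sum_filter => s0 i; rewrite mem_filter => /andP[ai _].
pose c' i := if alv (P i) h then c i else 0.
suff: c' i = 0 by rewrite /c' ai.
apply: (@tri_free c' h) => [j|j aj]; first by rewrite /c'; case: ifP; rewrite ?eqxx.
pose a j := if alv (P j) h then \sum_(i < N) C j i * c' i else 0.
suff: a j = 0 by rewrite /a aj.
apply: (expand0 BP (h := h)) => [k|]; first by rewrite /a; case: ifP; rewrite ?eqxx.
rewrite -[RHS]s0 [RHS]big_mkcond /=.
transitivity (\sum_(k < N) \sum_(i < N)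
    c' i *: ((if alv (P k) h then C k i else 0) *: elt (B k) h)).
  apply: eq_bigr => k _; rewrite /a; case: ifP => ak; last first.
    by rewrite scale0r big1 // => l _; rewrite scaler0.
  by rewrite scaler_suml; apply: eq_bigr => l _; rewrite scalerA mulrC.
rewrite exchange_big; apply: eq_bigr => l _; rewrite -scaler_sumr /c'.
case: ifP => [al|]; last by rewrite scale0r.
congr (_ *: _); move: al; case Pl: (P l) => [q|] //= /andP[ql _].
by rewrite (elt_mx_act_alive Pl ql).
Qed.

End Triangular.

Lemma mx_act1 X P (B : ext_family N X) : is_ext_basis P B -> mx_act 1%:M B = B.
Proof.
move=> BP; apply: funext => i; rewrite /mx_act; case Bi: (B i) => [[h x]|] //=.
rewrite (bigD1 i) //= big1 => [|j ji]; last by rewrite mxE (negbTE ji) scale0r.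
by rewrite mxE eqxx scale1r addr0 Bi /= phi_id_app.
Qed.

(** * Matrices of morphisms between based modules *)

Section Matrices.
Variables (X Y : persmod F R) (e : R) (P Q : 'I_N -> option (point R)).
Variables (BX : ext_family N X) (BY : ext_family N Y) (a : eps_morphism X Y e).
Hypotheses (BXP : is_ext_basis P BX) (BYQ : is_ext_basis Q BY).

Lemma contributesE i j x : BX i = Some x ->
  contributes e (BX i) (BY j) = alv (Q j) (tag x + e).
Proof.
move=> ->; rewrite /contributes; case Bj: (BY j) => [y|].
  by rewrite (alive_alv BYQ _ Bj).
by have := BYQ.1 j; rewrite Bj; case: (Q j).
Qed.

(** The condition on the summation range becomes a condition on the support of each column, which is
    the form of [expand] and [expand_inj]. *)
Lemma representsP (M : 'M[F]_N) : represents BX BY a M <->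
  (forall i j, BX i = None -> M j i = 0) /\
  (forall i x, BX i = Some x ->
    (forall j, M j i != 0 -> alv (Q j) (tag x + e)) /\
    a (tag x) (tagged x) = \sum_(j < N) M j i *: elt (BY j) (tag x + e)).
Proof.
have sumE i x : BX i = Some x ->
    (forall j, M j i != 0 -> alv (Q j) (tag x + e)) ->
    \sum_(j < N | contributes e (BX i) (BY j))
        M j i *: (if BY j is Some y
                  then phi (tag y) (tag x + e) (tagged y) else 0) =
    \sum_(j < N) M j i *: elt (BY j) (tag x + e).
  move=> Bi HM; rewrite big_mkcond; apply: eq_bigr => j _.
  rewrite (contributesE j Bi); case: ifPn => [|/negP nj].
    case Qj: (Q j) => [q|] //= /andP[qe _].
    by have [y -> _] := ext_basis_Some BYQ Qj; rewrite /= qe.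
  by have [->|/HM] := eqVneq (M j i) 0; rewrite ?scale0r.
split=> [[M0 Ma]|[M0 Ma]]; split.
- by move=> i j Bi; apply: M0; rewrite Bi.
- move=> i x Bi.
  have HM j : M j i != 0 -> alv (Q j) (tag x + e).
    by apply: contraR; rewrite -(contributesE j Bi) => /M0 ->.
  by split => //; rewrite (Ma _ _ Bi) sumE.
- move=> j i; case Bi: (BX i) => [x|]; last by move=> _; exact: M0.
  rewrite -Bi (contributesE j Bi) => nj; apply/eqP; apply: contraNT nj.
  exact: (Ma i x Bi).1.
- by move=> i x Bi; have [HM ->] := Ma i x Bi; rewrite sumE.
Qed.

Lemma represents_inj (M M' : 'M[F]_N) :
  represents BX BY a M -> represents BX BY a M' -> M = M'.
Proof.
move=> /representsP[M0 Ma] /representsP[M0' Ma']; apply/matrixP => j i.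
case Bi: (BX i) => [x|]; last by rewrite M0 ?M0'.
have [HM E] := Ma i x Bi; have [HM' E'] := Ma' i x Bi.
by apply: (expand_inj BYQ HM HM' _ j); rewrite -E -E'.
Qed.

Lemma represents_exists : exists M : 'M[F]_N, represents BX BY a M.
Proof.
have H i : exists c : 'I_N -> F, (BX i = None -> forall j, c j = 0) /\
    forall x, BX i = Some x -> (forall j, c j != 0 -> alv (Q j) (tag x + e)) /\
      a (tag x) (tagged x) = \sum_(j < N) c j *: elt (BY j) (tag x + e).
  case Bi: (BX i) => [x|]; last by exists (fun=> 0).
  have [c Hc E] := expand BYQ (a (tag x) (tagged x)).
  by exists c; split=> // _ [<-].
have [c Hc] := choice H; exists (\matrix_(j, i) c i j); apply/representsP; split.
  by move=> i j Bi; rewrite mxE (Hc i).1.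
move=> i x Bi; have [H1 H2] := (Hc i).2 x Bi.
split=> [j|]; first by rewrite mxE; exact: H1.
by rewrite H2; apply: eq_bigr => j _; rewrite mxE.
Qed.

Lemma Mat_represents : represents BX BY a (Mat BX BY a).
Proof.
exact: (@xgetPex _ (0 : 'M[F]_N) [set M | represents BX BY a M]
  represents_exists).
Qed.

Lemma Mat_eq M : represents BX BY a M -> Mat BX BY a = M.
Proof. exact/represents_inj/Mat_represents. Qed.

End Matrices.

End Algebra.

(** * Transport between times *)

Section Transport.
Variables (F : fieldType) (R : realType) (s0 s1 : R).
Variable V : vineyard_module F s0 s1.

Lemma composite_comp s h t H r G
    (f : 'Hom(V s h, V t H)) (g : 'Hom(V t H, V r G)) :
  composite s0 s1 (alpha V) (beta V) f ->
  composite s0 s1 (alpha V) (beta V) g ->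
  composite s0 s1 (alpha V) (beta V) (g \o f)%VF.
Proof.
move=> Hf; elim=> [|u k l e kl _ IH|u v k e ? ? ? _ IH|u v k e ? ? ? _ IH].
- by rewrite comp_lfun1l.
- by rewrite -comp_lfunA; apply: composite_phi.
- by rewrite -comp_lfunA; apply: composite_alpha.
- by rewrite -comp_lfunA; apply: composite_beta.
Qed.

Lemma composite_exists s h t H : s0 <= s <= s1 -> s0 <= t <= s1 ->
  h + `|s - t| <= H ->
  exists f : 'Hom(V s h, V t H), composite s0 s1 (alpha V) (beta V) f.
Proof.
move=> /andP[s0s ss1] /andP[s0t ts1] hH.
have [st|ts|st] := ltgtP s t.
- exists (phi _ H \o (alpha V s t h \o \1))%VF.
  apply: composite_phi => //; apply: composite_alpha => //.
  exact: composite_id.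
- rewrite distrC in hH; exists (phi _ H \o (beta V t s h \o \1))%VF.
  apply: composite_phi => //; apply: composite_beta => //.
  exact: composite_id.
- move: hH; rewrite st subrr normr0 addr0 => hH.
  by exists (phi h H \o \1)%VF; apply: composite_phi => //; apply: composite_id.
Qed.

(* All interleaving and transition maps are packed into one functor on the
   pairs (time, height), ordered by (s, h) <= (t, H) iff h + |s - t| <= H. *)
Definition tr s h t H : 'Hom(V s h, V t H) :=
  xget 0 [set f : 'Hom(V s h, V t H) | composite s0 s1 (alpha V) (beta V) f].

Lemma tr_composite s h t H : s0 <= s <= s1 -> s0 <= t <= s1 ->
  h + `|s - t| <= H -> composite s0 s1 (alpha V) (beta V) (tr s h t H).
Proof.
move=> hs ht hH.
exact: (@xgetPex _ (0 : 'Hom(V s h, V t H))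
  [set f | composite s0 s1 (alpha V) (beta V) f] (composite_exists hs ht hH)).
Qed.

Lemma tr_unique s h t H (f : 'Hom(V s h, V t H)) : s0 <= s <= s1 ->
  s0 <= t <= s1 -> h + `|s - t| <= H ->
  composite s0 s1 (alpha V) (beta V) f -> tr s h t H = f.
Proof.
by move=> hs ht hH Hf; apply: vineyard_commute => //; exact: tr_composite.
Qed.

Lemma tr_comp s h t H r G (v : V s h) : s0 <= s <= s1 -> s0 <= t <= s1 ->
  s0 <= r <= s1 -> h + `|s - t| <= H -> H + `|t - r| <= G ->
  tr t H r G (tr s h t H v) = tr s h r G v.
Proof.
move=> hs ht hr hH HG; rewrite -comp_lfunE; congr (fun_of_lfun _ v).
apply/esym/tr_unique => //; last by apply: composite_comp; exact: tr_composite.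
by have := ler_distD t s r; lra.
Qed.

Lemma tr_phi s h H (v : V s h) : s0 <= s <= s1 -> h <= H ->
  tr s h s H v = phi h H v.
Proof.
move=> hs hH; congr (fun_of_lfun _ v); apply: tr_unique => //.
  by rewrite subrr normr0 addr0.
rewrite -[phi h H]comp_lfun1r; apply: composite_phi => //.
exact: composite_id.
Qed.

Lemma tr_phi_r s h t H G (v : V s h) : s0 <= s <= s1 -> s0 <= t <= s1 ->
  h + `|s - t| <= H -> H <= G -> phi H G (tr s h t H v) = tr s h t G v.
Proof.
move=> hs ht hH HG; rewrite -tr_phi //; apply: tr_comp => //.
by rewrite subrr normr0 addr0.
Qed.

Lemma tr_phi_l s h g t H (v : V s h) : s0 <= s <= s1 -> s0 <= t <= s1 ->
  h <= g -> g + `|s - t| <= H -> tr s g t H (phi h g v) = tr s h t H v.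
Proof.
move=> hs ht hg gH; rewrite -tr_phi //; apply: tr_comp => //.
by rewrite subrr normr0 addr0.
Qed.

Lemma alpha_tr s t h (v : V s h) : s0 <= s -> s < t -> t <= s1 ->
  alpha V s t h v = tr s h t (h + `|s - t|) v.
Proof.
move=> hs st ht; congr (fun_of_lfun _ v); apply/esym/tr_unique => //.
- by rewrite hs (le_trans (ltW st)).
- by rewrite ht (le_trans hs (ltW st)).
rewrite -[emap _ _]comp_lfun1r; apply: composite_alpha => //.
exact: composite_id.
Qed.

Variables (N : nat) (gamma : 'I_N -> R -> option (point R)).
Hypothesis gproper : forall t, proper (gamma ^~ t).

(** The analogue of [represents] for [tr], with no order between s and t: it covers the maps
    backward in time as well as those forward in time. *)
Definition tr_matrix s t (Bs : ext_family N (V s)) (Bt : ext_family N (V t))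
    (A : 'M[F]_N) :=
  (forall i j, gamma i s = None -> A j i = 0) /\
  (forall i p, gamma i s = Some p ->
    (forall j, A j i != 0 -> alv (gamma j t) (p.1 + `|s - t|)) /\
    tr s p.1 t (p.1 + `|s - t|) (elt (Bs i) p.1) =
    \sum_(j < N) A j i *: elt (Bt j) (p.1 + `|s - t|)).

Section TwoTimes.
Variables (s t : R) (Bs : ext_family N (V s)) (Bt : ext_family N (V t)).
Hypotheses (hs : s0 <= s <= s1) (ht : s0 <= t <= s1).
Hypotheses (BsP : is_ext_basis (gamma ^~ s) Bs).
Hypotheses (BtP : is_ext_basis (gamma ^~ t) Bt).

Lemma tr_matrix_represents A : s < t ->
  tr_matrix Bs Bt A <-> represents Bs Bt (alpha V s t) A.
Proof.
move=> st; have /andP[hs0 _] := hs; have /andP[_ ht1] := ht.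
split=> [[A0 AE]|/(representsP _ _ BtP)[A0 AE]].
  apply/(representsP _ _ BtP); split=> [i j Bi|i x Bi].
    by apply: A0; have := BsP.1 i; rewrite Bi; case: (gamma i s).
  have [p Pi [tx _ _]] := ext_basis_point BsP Bi.
  case: x Bi tx => h x /= Bi tx; case: _ / (esym tx) x Bi => x Bi.
  have := AE i p Pi; rewrite Bi /= lexx phi_id_app => -[H1 H2].
  by split=> //; rewrite alpha_tr.
split=> [i j Pi|i p Pi]; first by apply: A0; exact: (ext_basis_None BsP Pi).
have [x Bi _] := ext_basis_Some BsP Pi.
have := AE i _ Bi; rewrite Bi /= lexx phi_id_app => -[H1 H2].
by split=> //; rewrite -alpha_tr.
Qed.

Lemma tr_matrix_Mat : s < t -> tr_matrix Bs Bt (Mat Bs Bt (alpha V s t)).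
Proof.
by move=> st; apply/tr_matrix_represents => //; exact: (Mat_represents _ _ BtP).
Qed.

Lemma Mat_tr_matrix A : s < t -> tr_matrix Bs Bt A ->
  Mat Bs Bt (alpha V s t) = A.
Proof. by move=> st /(tr_matrix_represents _ st); exact: (Mat_eq BtP). Qed.

Lemma tr_matrix_exists : exists A, tr_matrix Bs Bt A.
Proof.
have H i : exists c : 'I_N -> F, (gamma i s = None -> forall j, c j = 0) /\
    forall p, gamma i s = Some p ->
      (forall j, c j != 0 -> alv (gamma j t) (p.1 + `|s - t|)) /\
      tr s p.1 t (p.1 + `|s - t|) (elt (Bs i) p.1) =
      \sum_(j < N) c j *: elt (Bt j) (p.1 + `|s - t|).
  case Pi: (gamma i s) => [p|]; last by exists (fun=> 0).
  have [c Hc E] := expand BtP (tr s p.1 t (p.1 + `|s - t|) (elt (Bs i) p.1)).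
  by exists c; split=> // _ [<-].
have [c Hc] := choice H; exists (\matrix_(j, i) c i j); split.
  by move=> i j Pi; rewrite mxE (Hc i).1.
move=> i p Pi; have [H1 H2] := (Hc i).2 p Pi.
split=> [j|]; first by rewrite mxE; exact: H1.
by rewrite H2; apply: eq_bigr => j _; rewrite mxE.
Qed.

Lemma tr_matrix_push A i p g H : tr_matrix Bs Bt A -> gamma i s = Some p ->
  p.1 <= g -> g + `|s - t| <= H ->
  tr s g t H (elt (Bs i) g) = \sum_(j < N) A j i *: elt (Bt j) H.
Proof.
move=> [_ AE] Pi pg gH; have [Aa E] := AE i p Pi.
rewrite -(elt_phi BsP Pi (lexx _) pg) tr_phi_l //.
have pH : p.1 + `|s - t| <= H by lra.
rewrite -(tr_phi_r _ hs ht (lexx _) pH) E linear_sum.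
apply: eq_bigr => j _; rewrite linearZ /=.
have [->|/Aa] := eqVneq (A j i) 0; first by rewrite !scale0r.
case Pj: (gamma j t) => [q|] //= /andP[qp _].
by rewrite (elt_phi BtP Pj qp pH).
Qed.

(** At height p.2 + |s - t| the image of element i is 0. If vine j were still alive there,
    independence would force its coefficient to vanish. *)
Lemma tr_matrix_death A i j p q : tr_matrix Bs Bt A -> gamma i s = Some p ->
  gamma j t = Some q -> A j i != 0 -> (q.2 <= p.2 + (`|s - t|)%:E)%E.
Proof.
move=> HA Pi Pj Aji; have [Aa _] := HA.2 i p Pi.
have := Aa j Aji; rewrite Pj /= => /andP[qp _].
have := gproper Pi; case Ep2: p.2 => [d| |] //; last by rewrite addye ?leey.
rewrite lte_fin => pd; rewrite leNgt -EFinD; apply/negP => dq.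
have := tr_matrix_push HA Pi (ltW pd) (lexx _).
rewrite (elt_notalive BsP) ?Pi /= ?Ep2 ?ltxx ?andbF // linear0 => E.
have E' : \sum_(j < N) (if alv (gamma j t) (d + `|s - t|) then A j i else 0)
    *: elt (Bt j) (d + `|s - t|) = 0.
  rewrite [RHS]E; apply: eq_bigr => k _; case: ifPn => // nk.
  by rewrite (elt_notalive BtP nk) !scaler0.
have := expand0 BtP _ E' j; rewrite Pj /= dq andbT.
have -> : q.1 <= d + `|s - t| by lra.
move=> /(_ _)/eqP; rewrite (negbTE Aji) => H; apply: notF; apply: H => k.
by case: ifP; rewrite ?eqxx.
Qed.

End TwoTimes.

(** If the bar p outlasts the round trip, the (i, i) entry of M A is 1, so some j carries a nonzero
    term. Its two factors bound births and deaths in both directions. *)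
Lemma tr_matrix_round s t (Bs : ext_family N (V s)) (Bt : ext_family N (V t))
    (hs : s0 <= s <= s1) (ht : s0 <= t <= s1)
    (BsP : is_ext_basis (gamma ^~ s) Bs) (BtP : is_ext_basis (gamma ^~ t) Bt)
    A M i p : tr_matrix Bs Bt A -> tr_matrix Bt Bs M -> gamma i s = Some p ->
  ((p.1 + `|s - t| + `|s - t|)%:E < p.2)%E ->
  exists j q, [/\ gamma j t = Some q, A j i != 0, M i j != 0 &
    points_close `|s - t| p q].
Proof.
move=> HA HM Pi pp.
have [Aa AE] := HA.2 i p Pi.
set e := `|s - t| in pp AE Aa *; set h := p.1 + e in AE pp Aa *.
have e0 : 0 <= e by rewrite /e.
have E : elt (Bs i) (h + e) = \sum_(k < N) (\sum_(j < N) M k j * A j i) *: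
    elt (Bs k) (h + e).
  have -> : elt (Bs i) (h + e) = tr t h s (h + e) (tr s p.1 t h (elt (Bs i) p.1)).
    have he : p.1 <= h + e by rewrite /h; lra.
    rewrite tr_comp ?tr_phi // ?(elt_phi BsP Pi) ?lexx //.
    by rewrite distrC lexx.
  rewrite AE linear_sum.
  transitivity (\sum_(j < N) \sum_(k < N) (M k j * A j i) *: elt (Bs k) (h + e)).
    apply: eq_bigr => j _; rewrite linearZ /=.
    have [->|/Aa] := eqVneq (A j i) 0.
      by rewrite scale0r big1 // => k _; rewrite mulr0 scale0r.
    case Pj: (gamma j t) => [q|] //= /andP[qh _].
    rewrite (tr_matrix_push ht hs BtP BsP HM Pj qh) ?(distrC t) //.
    by rewrite scaler_sumr; apply: eq_bigr => k _; rewrite scalerA mulrC.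
  by rewrite exchange_big; apply: eq_bigr => k _; rewrite scaler_suml.
(* Element i is still alive at height h + e, so its coefficient there can be compared. *)
have E1 : \sum_(j < N) M i j * A j i = 1.
  pose c k := if alv (gamma k s) (h + e) then \sum_(j < N) M k j * A j i else 0.
  have ai : alv (gamma i s) (h + e) by rewrite Pi /= pp andbT /h; lra.
  have := expand_inj BsP (c := c) (c' := fun k => (k == i)%:R) (h := h + e) _ _ _ i.
  rewrite /c ai eqxx; apply.
  - by move=> k; case: ifP; rewrite ?eqxx.
  - by move=> k; case: (eqVneq k i) => [->|]; rewrite ?eqxx.
  rewrite -elt_delta E; apply: eq_bigr => k _; case: ifPn => // nk.
  by rewrite (elt_notalive BsP nk) !scaler0.
have [j /andP[Mij Aji]] : exists j, (M i j != 0) && (A j i != 0).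
  apply: contrapT => /forallNP H; move: E1; rewrite big1 => [/eqP|j _].
    by rewrite eq_sym oner_eq0.
  have /negP := H j; rewrite negb_and !negbK => /orP[]/eqP ->;
  by rewrite ?mul0r ?mulr0.
have := Aa j Aji; case Pj: (gamma j t) => [q|] //= /andP[qh _].
exists j, q; split => //.
have [Ma _] := HM.2 j q Pj; have := Ma i Mij; rewrite Pi /= distrC => /andP[pq _].
split; first by rewrite ler_norml; rewrite /h in qh; rewrite -/e in pq; lra.
  rewrite /e distrC; exact: (tr_matrix_death ht hs BtP BsP HM Pj Pi Mij).
exact: (tr_matrix_death hs ht BsP BtP HA Pi Pj Aji).
Qed.

End Transport.

(** * Interval induction *)

Section IntervalInduction.
Variable R : realType.

(* Cousin's lemma. *)
Lemma cousin (P : R -> R -> Prop) (x y : R) : x <= y ->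
  (forall u, x <= u <= y -> exists2 delta : R, 0 < delta &
    forall c d, x <= c -> c <= u <= d -> d <= y -> d - c < delta -> P c d) ->
  (forall c d e, x <= c -> c <= d -> d <= e -> e <= y ->
    P c d -> P d e -> P c e) ->
  P x y.
Proof.
move=> xy loc add.
pose E := [set t | x <= t <= y /\ P x t].
have Ex : E x.
  split; first by rewrite lexx.
  have [|d d0 H] := loc x; first by rewrite lexx.
  by apply: H; rewrite ?lexx ?subrr.
have Eub : ubound E y by move=> t [/andP[]].
have supE : has_sup E by split; [exists x|exists y].
have xs : x <= sup E by apply: ub_le_sup => //; exists y.
have sy : sup E <= y by apply: ge_sup => //; exists x.
have [|d d0 H] := loc (sup E); first by rewrite xs sy.
have d20 : 0 < d / 2 by lra.
have [t [/andP[xt ty] Pxt] st] := sup_adherent d20 supE.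
have ts : t <= sup E.
  by apply: ub_le_sup; [exists y|split=> //; rewrite xt].
pose z := Num.min y (sup E + d / 4).
have zy : z <= y by rewrite ge_min lexx.
have sz : sup E <= z by rewrite le_min sy /=; lra.
have zs : z <= sup E + d / 4 by rewrite ge_min lexx orbT.
have Pxz : P x z.
  apply: (add x t z) => //; first by lra.
  by apply: H => //; [rewrite ts|lra].
have : z <= sup E.
  by apply: ub_le_sup; [exists y|split=> //; rewrite zy andbT; lra].
by rewrite ge_min => /orP[ys|]; [suff -> : y = z by []|]; [apply/le_anti|]; lra.
Qed.

Variables (X : Type) (rel : R -> R -> X -> X -> Prop).

(** Here [rel w w y y] says that y is an admissible value at time w. Transitivity is asked only for
    monotone triples of times, because only then do the shifts |r - s| and |s - t| add up to |r -
    t|; gluing at d respects this. Compactness yields a family on each [c, b] with a < c, and these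
    are made compatible to cover the half-open interval. *)
Lemma path_lift_left (a b : R) : a < b ->
  (forall r s t x y z, a < r <= b -> a < s <= b -> a < t <= b ->
    (r <= s <= t \/ t <= s <= r) -> rel r s x y -> rel s t y z ->
    rel r t x z) ->
  (forall u, a < u <= b -> exists2 delta : R, 0 < delta &
    forall c d, a < c -> c <= u <= d -> d <= b -> d - c < delta ->
    forall w y, w = c \/ w = d -> rel w w y y ->
    exists f : R -> X, f w = y /\
      forall s t, c <= s <= d -> c <= t <= d -> rel s t (f s) (f t)) ->
  forall y, rel b b y y -> exists f : R -> X, f b = y /\
    forall s t, a < s <= b -> a < t <= b -> rel s t (f s) (f t).
Proof.
move=> ab trans loc y0 y0b.
pose coh c d (f : R -> X) := forall s t, c <= s <= d -> c <= t <= d ->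
  rel s t (f s) (f t).
have glue c d e (f g : R -> X) : a < c -> c <= d -> d <= e -> e <= b ->
    coh c d f -> coh d e g -> f d = g d ->
    coh c e (fun t => if t < d then f t else g t).
  move=> ac cd de eb cf cg fg.
  have fE t : t <= d -> (if t < d then f t else g t) = f t.
    by rewrite le_eqVlt => /orP[/eqP ->|->//]; rewrite ltxx.
  have gE t : d <= t -> (if t < d then f t else g t) = g t.
    by move=> dt; rewrite ltNge dt.
  move=> s t /andP[cs se] /andP[ct te].
  have [sd|ds] := leP s d; have [td|dt] := leP t d.
  - by rewrite !fE //; apply: cf; lra.
  - rewrite fE // gE ?(ltW dt) //.
    apply: (trans _ d _ _ (f d)); [lra|lra|lra|left; lra|apply: cf; lra|].
    by rewrite fg; apply: cg; lra.
  - rewrite (fE t) // gE ?(ltW ds) //.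
    apply: (trans _ d _ _ (f d)); [lra|lra|lra|right; lra| |apply: cf; lra].
    by rewrite fg; apply: cg; lra.
  - by rewrite !gE ?ltW //; apply: cg; lra.
have ext c d : a < c -> c <= d -> d <= b -> forall y, rel d d y y ->
    exists f, f d = y /\ coh c d f.
  move=> ac cd db; apply: (@cousin (fun c d => forall y, rel d d y y ->
    exists f, f d = y /\ coh c d f)) => //
    [u /andP[cu ud]|c1 c2 c3 h1 h2 h3 h4 H1 H2 y yy].
    have [|de de0 H] := loc u; first by lra.
    exists de => // c1 d1 h1 h2 h3 h4 y yy.
    by apply: (H c1 d1 _ _ _ _ d1 y) => //; [lra|lra|right].
  have [g [gy cg]] := H2 y yy.
  have [|f [fg cf]] := H1 (g c2); first by apply: cg; lra.
  exists (fun t => if t < c2 then f t else g t); split.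
    by rewrite ltNge h3.
  by apply: glue => //; lra.
(* c 0 = b, and c decreases to a. *)
pose c (n : nat) := a + (b - a) / n.+1%:R.
have ac n : a < c n by rewrite ltrDl divr_gt0 // subr_gt0.
have cS n : c n.+1 <= c n.
  rewrite lerD2l ler_pM2l ?subr_gt0 // lef_pV2 ?posrE // ler_nat.
  by [].
have cb n : c n <= b.
  elim: n => [|n]; first by rewrite /c divr1; lra.
  exact/le_trans/cS.
(* Coherence is a premise inside the statement, so that [step] is total and can be iterated by plain
   recursion; coherence is recovered afterwards by induction. *)
have /choice[step stepP] : forall nf : nat * (R -> X), exists f',
    coh (c nf.1) b nf.2 -> coh (c nf.1.+1) b f' /\
      forall t, c nf.1 <= t -> f' t = nf.2 t.
  move=> [n f] /=; have [cf|ncf] := pselect (coh (c n) b f); last by exists f.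
  have [|g [gf cg]] := ext _ _ (ac n.+1) (cS n) (cb n) (f (c n)).
    by apply: cf; rewrite lexx cb.
  exists (fun t => if t < c n then g t else f t) => _; split.
    by apply: glue => //; exact: cS.
  by move=> t ct; rewrite ltNge ct.
pose G := fix G n := if n is m.+1 then step (m, G m) else fun=> y0.
have cG n : coh (c n) b (G n).
  elim: n => [|n IH]; last by have [] := stepP (n, G n) IH.
  move=> s t; rewrite {1 2}/c divr1 addrC subrK => hs ht.
  have -> : s = b by apply/le_anti; rewrite andbC.
  by have -> : t = b by apply/le_anti; rewrite andbC.
have GS n t : c n <= t -> G n.+1 t = G n t.
  by have [_ H] := stepP (n, G n) (cG n); exact: H.
have Gle n m t : (n <= m)%N -> c n <= t -> G m t = G n t.
  elim: m => [|m IH]; first by rewrite leqn0 => /eqP ->.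
  rewrite leq_eqVlt => /orP[/eqP ->//|]; rewrite ltnS => nm ct.
  rewrite GS ?IH //; apply: le_trans ct.
  by rewrite lerD2l ler_pM2l ?subr_gt0 // lef_pV2 ?posrE // ler_nat ltnS.
(* A stage at which t is covered; later stages keep the value at t. *)
have /choice[m mP] : forall t, exists n, a < t -> c n <= t.
  move=> t.
  have [at_|] := ltP a t; last by exists 0%N.
  exists (Num.truncn ((b - a) / (t - a))) => _.
  rewrite /c -lerBrDl ler_pdivrMr // mulrC -ler_pdivrMr ?subr_gt0 //.
  by apply/ltW/truncnS_gt.
exists (fun t => G (m t) t); split.
  by rewrite (Gle 0%N) // /c divr1; lra.
move=> s t hs ht.
have [ms mt] := (mP s (proj1 (andP hs)), mP t (proj1 (andP ht))).
rewrite -(Gle _ (maxn (m s) (m t)) s (leq_maxl _ _)) //.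
rewrite -(Gle _ (maxn (m s) (m t)) t (leq_maxr _ _)) //.
have cmax k x : (k <= maxn (m s) (m t))%N -> c k <= x -> c (maxn (m s) (m t)) <= x.
  move=> km; apply: le_trans.
  by rewrite lerD2l ler_pM2l ?subr_gt0 // lef_pV2 ?posrE // ler_nat ltnS.
apply: cG.
  by rewrite (cmax (m s)) ?leq_maxl //; case/andP: hs.
by rewrite (cmax (m t)) ?leq_maxr //; case/andP: ht.
Qed.

End IntervalInduction.

(** The reflection t -> - t of [path_lift_left]. *)
Lemma path_lift_right (R : realType) (X : Type) (rel : R -> R -> X -> X -> Prop)
    (a b : R) : a < b ->
  (forall r s t x y z, a <= r < b -> a <= s < b -> a <= t < b ->
    (r <= s <= t \/ t <= s <= r) -> rel r s x y -> rel s t y z ->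
    rel r t x z) ->
  (forall u, a <= u < b -> exists2 delta : R, 0 < delta &
    forall c d, a <= c -> c <= u <= d -> d < b -> d - c < delta ->
    forall w y, w = c \/ w = d -> rel w w y y ->
    exists f : R -> X, f w = y /\
      forall s t, c <= s <= d -> c <= t <= d -> rel s t (f s) (f t)) ->
  forall y, rel a a y y -> exists f : R -> X, f a = y /\
    forall s t, a <= s < b -> a <= t < b -> rel s t (f s) (f t).
Proof.
move=> ab trans loc y ya.
have ba : - b < - a by rewrite ltrN2.
have [|u hu||f [fa fr]] := @path_lift_left R X (fun s t => rel (- s) (- t)) _ _ ba
    _ _ y.
- move=> r s t x1 x2 x3 hr hs ht hm; apply: trans; [lra|lra|lra|].
  by case: hm => ?; [right|left]; lra.
- have [|de de0 H] := loc (- u); first by lra.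
  exists de => // c d h1 h2 h3 h4 w x wcd xw.
  have [|||||f [fw fr]] := H (- d) (- c) _ _ _ _ (- w) x _ xw.
  + by lra.
  + by lra.
  + by lra.
  + by lra.
  + by case: wcd => ->; [right|left].
  exists (fun t => f (- t)); split=> // s t hs ht.
  by apply: fr; lra.
- by rewrite opprK.
exists (fun t => f (- t)); split=> // s t hs ht.
have := fr (- s) (- t); rewrite !opprK; apply; lra.
Qed.

(** * Points and vines *)

Section Closeness.
Variable R : realType.
Implicit Types (p q r : point R) (e f : R) (u v : \bar R).

Lemma uniform_delta (I : finType) (Q : I -> R -> Prop) :
  (forall i (x y : R), 0 < y -> y <= x -> Q i x -> Q i y) ->
  (forall i, exists2 x : R, 0 < x & Q i x) -> exists2 x : R, 0 < x & forall i, Q i x.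
Proof.
move=> mono H; have /choice[x xP] : forall i, exists x, 0 < x /\ Q i x.
  by move=> i; have [x x0 Qx] := H i; exists x.
have m0 : 0 < \big[Num.min/1]_(i : I) x i.
  apply: (big_ind (fun y => 0 < y)) => // [y z y0 z0|i _]; last by have [] := xP i.
  by rewrite lt_min y0.
exists (\big[Num.min/1]_(i : I) x i) => // i; have [_ Qi] := xP i.
by apply: mono Qi => //; exact: bigmin_le.
Qed.

Lemma points_closeP e p q : points_close e p q <->
  forall s, (coordinate p s <= coordinate q s + e%:E)%E /\
            (coordinate q s <= coordinate p s + e%:E)%E.
Proof.
split=> [[pq pq2 qp2] [|] //=|H].
  rewrite -!EFinD !lee_fin; move: pq; rewrite ler_norml => /andP[? ?]; lra.
have [/= H1 H2] := H false; have [/= H3 H4] := H true.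
split=> //; move: H1 H2; rewrite -!EFinD !lee_fin ler_norml; lra.
Qed.

Lemma points_close_sym e p q : points_close e p q -> points_close e q p.
Proof. by move=> [? ? ?]; split=> //; rewrite distrC. Qed.

Lemma lee_add_trans u v w e f : (u <= v + e%:E)%E -> (v <= w + f%:E)%E ->
  (u <= w + (f + e)%:E)%E.
Proof.
move=> uv vw; apply: (le_trans uv); rewrite EFinD addeA.
by rewrite leeD2r.
Qed.

Lemma points_close_trans e f p q r : points_close e p q ->
  points_close f q r -> points_close (e + f) p r.
Proof.
move=> /points_closeP pq /points_closeP qr; apply/points_closeP => s.
have [p1 p2] := pq s; have [q1 q2] := qr s; split.
  by rewrite [e + f]addrC; exact: lee_add_trans p1 q1.
exact: lee_add_trans q2 p2.
Qed.

Lemma points_close_le e f p q : e <= f -> points_close e p q ->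
  points_close f p q.
Proof.
move=> ef /points_closeP pq; apply/points_closeP => s.
have [p1 p2] := pq s; split; [apply: (le_trans p1)|apply: (le_trans p2)];
by rewrite leeD2l // lee_fin.
Qed.

Lemma points_close_lim e p q :
  (forall f, 0 < f -> points_close (e + f) p q) -> points_close e p q.
Proof.
move=> H; apply/points_closeP => s; split; apply/lee_addgt0Pr => f f0;
have /points_closeP/(_ s)[H1 H2] := H f f0;
by rewrite -addeA -EFinD.
Qed.

Lemma points_close0 p q : points_close 0 p q -> p = q.
Proof.
move=> [pq]; rewrite !adde0 => p2 q2.
case: p q pq p2 q2 => [p1 p2] [q1 q2] /= pq pq2 qp2; congr (_, _).
  by apply/eqP; rewrite -subr_eq0 -normr_le0.
by apply/le_anti/andP.
Qed.

Lemma points_close_refl p : points_close 0 p p.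
Proof. by split; rewrite ?subrr ?normr0 ?adde0. Qed.

Lemma points_far p q : p <> q -> exists2 e : R, 0 < e & ~ points_close e p q.
Proof.
move=> pq; apply: contrapT => H; apply: pq; apply: points_close0.
apply: points_close_lim => f f0; rewrite add0r; apply: contrapT => npq.
by apply: H; exists f.
Qed.

Lemma lt_shift u v u' v' (x y z g : R) : (-oo < u)%E -> (u < v)%E ->
  (u + g%:E <= v)%E -> (u' <= u + x%:E)%E -> (v <= v' + y%:E)%E ->
  x + y + z < g -> (u' + z%:E < v')%E.
Proof.
case: u => [u| |] // _; last by case: v.
case: v => [v| |] //; case: v' => [v'| |] //; case: u' => [u'| |] //=;
  rewrite -?EFinD ?lee_fin ?lte_fin ?ltry ?ltNyr //.
by move=> *; lra.
Qed.

End Closeness.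

Section Separation.
Variables (R : realType) (N : nat).

(** Coinciding values are allowed; only a strict inequality must have margin g. The condition thus
    makes sense at a critical time, and births and deaths are compared with each other. *)
Definition sep (g : R) (P : 'I_N -> option (point R)) := forall i j p q s s',
  P i = Some p -> P j = Some q -> (coordinate p s < coordinate q s')%E ->
  (coordinate p s + g%:E <= coordinate q s')%E.

Lemma sep_exists (P : 'I_N -> option (point R)) :
  (forall i p s, P i = Some p -> (-oo < coordinate p s)%E) ->
  exists2 g : R, 0 < g & sep g P.
Proof.
move=> Pfin.
have [|[[i j] [s s']]|g g0 gP] := @uniform_delta R
  (('I_N * 'I_N) * (bool * bool))%type (fun k g => forall p q,
    P k.1.1 = Some p -> P k.1.2 = Some q ->
    (coordinate p k.2.1 < coordinate q k.2.2)%E ->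
    (coordinate p k.2.1 + g%:E <= coordinate q k.2.2)%E).
- move=> k x y y0 yx H p q Pp Pq pq; apply: le_trans (H p q Pp Pq pq).
  by rewrite leeD2l // lee_fin.
- rewrite /=; case Pi: (P i) => [p|]; last by exists 1.
  case Pj: (P j) => [q|]; last by exists 1.
  have := Pfin i p s Pi.
  case Ep: (coordinate p s) => [u| |] // _;
    case Eq: (coordinate q s') => [v| |];
    try by exists 1 => // _ _ [<-] [<-]; rewrite Ep Eq ?leey.
  have [uv|vu] := ltP u v.
    exists (v - u); first by rewrite subr_gt0.
    by move=> _ _ [<-] [<-] _; rewrite Ep Eq -EFinD lee_fin addrC subrK.
  by exists 1 => // _ _ [<-] [<-]; rewrite Ep Eq lte_fin ltNge vu.
by exists g => // i j p q s s' Pi Pj; exact: (gP ((i, j), (s, s'))).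
Qed.

End Separation.

(** * Continuity of a single vine *)

Section OneVine.
Variables (R : realType) (s0 s1 : R) (g : R -> option (point R)).
Implicit Types (a b t u e : R).
Hypothesis gvine : is_vine s0 s1 g.

Lemma vine_continuous t p e : s0 <= t <= s1 -> g t = Some p -> 0 < e ->
  exists2 delta : R, 0 < delta & forall u, s0 <= u <= s1 -> `|u - t| < delta ->
    exists2 q, g u = Some q & points_close e p q.
Proof.
move=> ht gt e0; have [_ _ _ prop cont] := gvine.
(* With a radius for which p is not near the diagonal, p has to be matched, and the only candidate
   is the point of the vine at time u. *)
have [f [f0 fe nd]] : exists f : R, [/\ 0 < f, f <= e & ~ near_diagonal f p].
  have := prop t p gt; rewrite /near_diagonal.
  case: p.2 => [d| |] // pd; last by exists e.
  rewrite lte_fin in pd; exists (Num.min e ((d - p.1) / 4)).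
  have m4 : Num.min e ((d - p.1) / 4) <= (d - p.1) / 4 by rewrite ge_min lexx orbT.
  split; [|by rewrite ge_min lexx|].
    by rewrite lt_min e0 /=; lra.
  by rewrite lee_fin; apply/negP; rewrite -ltNge; lra.
have [d d0 H] := cont t ht f f0; exists d => // u hu ut.
have [M [M1 _ M3 _]] := H u hu ut.
have /M3[[m mM mp]|//] : p \in vine_diagram g t.
  by rewrite /vine_diagram gt inE.
have [_ + pc] := M1 m mM; rewrite /vine_diagram.
case gu: (g u) => [q|]; last by rewrite inE.
rewrite inE => /eqP mq; exists q => //.
by rewrite -mp -mq; exact: points_close_le pc.
Qed.

Lemma vine_near_diagonal t e : s0 <= t <= s1 -> g t = None -> 0 < e ->
  exists2 delta : R, 0 < delta & forall u q, s0 <= u <= s1 ->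
    `|u - t| < delta -> g u = Some q -> near_diagonal e q.
Proof.
move=> ht gt e0; have [_ _ _ _ cont] := gvine.
have [d d0 H] := cont t ht e e0; exists d => // u q hu ut gu.
have [M [M1 _ _ M4]] := H u hu ut.
have /M4[[m mM _]|//] : q \in vine_diagram g u.
  by rewrite /vine_diagram gu inE.
by have [] := M1 m mM; rewrite /vine_diagram gt inE.
Qed.

(** If the support came arbitrarily close to t from the right, being an interval it would contain a
    whole (t, w), so the vine would appear at t. *)
Lemma absent_right t : ~ supp g t -> ~ appears g t ->
  exists2 delta : R, 0 < delta & forall u, t < u < t + delta -> ~ supp g u.
Proof.
move=> nt na; apply: contrapT => H.
have G (d : R) : 0 < d -> exists2 u, t < u < t + d & supp g u.
  move=> d0; apply: contrapT => H'; apply: H; exists d => // u hu su.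
  by apply: H'; exists u.
have [_ _ itv _ _] := gvine.
have [w hw sw] := G 1 ltr01; apply: na; split=> //.
exists (w - t); first by lra.
move=> u hu; have [|v hv sv] := G (u - t); first by lra.
by apply: (itv v w sv sw); lra.
Qed.

Lemma absent_left t : ~ supp g t -> ~ disappears g t ->
  exists2 delta : R, 0 < delta & forall u, t - delta < u < t -> ~ supp g u.
Proof.
move=> nt na; apply: contrapT => H.
have G (d : R) : 0 < d -> exists2 u, t - d < u < t & supp g u.
  move=> d0; apply: contrapT => H'; apply: H; exists d => // u hu su.
  by apply: H'; exists u.
have [_ _ itv _ _] := gvine.
have [w hw sw] := G 1 ltr01; apply: na; split=> //.
exists (t - w); first by lra.
move=> u hu; have [|v hv sv] := G (t - u); first by lra.
by apply: (itv w v sw sv); lra.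
Qed.

(** Presence is locally constant: continuity keeps a present vine present, and a vine absent at a
    time where it neither appears nor disappears is absent on both sides. Cousin's lemma makes this
    global. *)
Lemma supp_constant a b : s0 <= a -> b <= s1 ->
  (forall t, a < t < b -> ~ appears g t /\ ~ disappears g t) ->
  forall t u, a < t < b -> a < u < b -> isSome (g t) = isSome (g u).
Proof.
move=> s0a bs1 nc.
have main t u : a < t -> t <= u -> u < b -> isSome (g t) = isSome (g u).
  move=> at_ tu ub; apply: (@cousin R (fun c d => isSome (g c) = isSome (g d))) => //.
    move=> w hw; case gw: (g w) => [p|].
      have [|d d0 H] := @vine_continuous w p 1 _ gw ltr01; first by lra.
      exists d => // x y h1 h2 h3 h4.
      have [||? -> _] := H x; [by lra|by rewrite ltr_norml; lra|].
      by have [||? -> _] := H y; [by lra|by rewrite ltr_norml; lra|].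
    have nw : ~ supp g w by rewrite /supp /= gw.
    have [|na nd] := nc w; first by lra.
    have [d d0 Hd] := absent_right nw na; have [e e0 He] := absent_left nw nd.
    have none v : w - e < v < w + d -> g v = None.
      move=> hv; have [vw|wv|->] := ltgtP v w.
      - by have := He v; rewrite /supp /=; case: (g v) => // ? H; case: H => //; lra.
      - by have := Hd v; rewrite /supp /=; case: (g v) => // ? H; case: H => //; lra.
      - by [].
    have me : Num.min d e <= e by rewrite ge_min lexx orbT.
    have md : Num.min d e <= d by rewrite ge_min lexx.
    exists (Num.min d e) => [|x y h1 h2 h3 h4]; first by rewrite lt_min d0.
    by rewrite !none //; lra.
  by move=> x y z _ _ _ _ -> ->.
move=> t u ht hu; have [tu|ut] := leP t u; first by apply: main; lra.
by apply/esym/main; lra.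
Qed.

End OneVine.

Section ShiftedPoints.
Variables (R : realType) (N : nat) (g : R) (cen : 'I_N -> option (point R)).
Hypothesis censep : sep g cen.
Hypothesis cenfin : forall i p s, cen i = Some p -> (-oo < coordinate p s)%E.

(** Strict inequalities between central values survive because the shifts stay below the gap. Ties
    are settled by h >= y.1 + x: a birth tied with y.1 has happened by h, and a death tied with y.1
    too. *)
Lemma alive_shift i j (y r q : point R) (x z h : R) : cen i = Some y ->
  cen j = Some r -> points_close x r q -> y.1 + x <= h <= y.1 + z ->
  x + z < g -> alv (Some q) h = (r.1 <= y.1) && (y.1%:E < r.2)%E.
Proof.
move=> cy cr [+ rq qr] /andP[h1 h2] xzg /=; rewrite ler_norml => /andP[r1 r2].
congr (_ && _).
  have [ry|yr] := leP r.1 y.1; first lra.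
  have := @censep i j y r false false cy cr; rewrite /= lte_fin => /(_ yr).
  rewrite -EFinD lee_fin => gr; apply/negbTE; rewrite -ltNge; move: censep; lra.
have [yr|ry] := ltP y.1%:E r.2.
  have := @censep i j y r false true cy cr yr => gr.
  have := @lt_shift R y.1%:E r.2 y.1%:E q.2 0 x z g.
  rewrite addr0 ltNyr add0r => /(_ isT yr gr _ rq xzg); rewrite lexx => /(_ isT).
  by apply: le_lt_trans; rewrite -EFinD lee_fin.
apply/negbTE; rewrite -leNgt; apply: (le_trans qr).
by apply: (le_trans (leeD2r _ ry)); rewrite -EFinD lee_fin.
Qed.

Lemma death_shift i j (y r p q : point R) (x x' z : R) : cen i = Some y ->
  cen j = Some r -> points_close x r q -> points_close x' y p ->
  (q.2 <= p.2 + z%:E)%E -> x + x' + z < g -> (r.2 <= y.2)%E.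
Proof.
move=> cy cr [_ rq _] [_ _ py] qp H; rewrite leNgt; apply/negP => yr.
have yr2 := @censep i j y r true true cy cr yr.
have := lt_shift (cenfin true cy) yr yr2 py rq (z := z).
by rewrite [x' + x]addrC => /(_ H); rewrite ltNge qp.
Qed.

End ShiftedPoints.

(** Lets an equality of vectors be checked at a later height, where more composites of structure
    maps are available. *)
Lemma phi_injective (F : fieldType) (R : realType) (N : nat) (X : persmod F R)
    (P : 'I_N -> option (point R)) (B : ext_family N X) (h H : R) (v w : X h) :
  is_ext_basis P B -> h <= H ->
  (forall j p, P j = Some p -> (h%:E < p.2)%E -> (H%:E < p.2)%E) ->
  phi h H v = phi h H w -> v = w.
Proof.
move=> BP hH stay; have [c Hc ->] := expand BP v; have [d Hd ->] := expand BP w.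
have push (e : 'I_N -> F) : (forall i, e i != 0 -> alv (P i) h) ->
    phi h H (\sum_(i < N) e i *: elt (B i) h) = \sum_(i < N) e i *: elt (B i) H.
  move=> He; rewrite linear_sum; apply: eq_bigr => i _; rewrite linearZ /=.
  have [->|/He] := eqVneq (e i) 0; first by rewrite !scale0r.
  by case Pi: (P i) => [p|] //= /andP[ph _]; rewrite (elt_phi BP Pi ph hH).
have alive_later (e : 'I_N -> F) : (forall i, e i != 0 -> alv (P i) h) ->
    forall i, e i != 0 -> alv (P i) H.
  move=> He i /He; case Pi: (P i) => [p|] //= /andP[ph hp].
  by rewrite (le_trans ph hH) (stay i p).
rewrite !push // => /(expand_inj BP (alive_later c Hc) (alive_later d Hd)) cd.
by apply: eq_bigr => i _; rewrite cd.
Qed.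

(** * Matrices between a central time s and a nearby time t *)

Section Center.
Variables (F : fieldType) (R : realType) (s0 s1 : R).
Variables (V : vineyard_module F s0 s1) (N : nat).
Variable gamma : 'I_N -> R -> option (point R).
Hypothesis gproper : forall t, proper (gamma ^~ t).
Hypothesis gsimple : forall t, simple (gamma ^~ t).
Variables (s t : R) (hs : s0 <= s <= s1) (ht : s0 <= t <= s1).
Variables (Bs : ext_family N (V s)) (Bt : ext_family N (V t)).
Hypotheses (BsP : is_ext_basis (gamma ^~ s) Bs).
Hypotheses (BtP : is_ext_basis (gamma ^~ t) Bt).
Variables (g : R) (cen : 'I_N -> option (point R)).
Hypothesis censep : sep g cen.
Hypothesis cenfin : forall i p s, cen i = Some p -> (-oo < coordinate p s)%E.
Hypothesis cen_supp : forall i p, gamma i s = Some p -> cen i = Some p.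
Hypothesis cen_close : forall i q, gamma i t = Some q ->
  exists2 r, cen i = Some r & points_close `|s - t| r q.
Hypothesis cen_proper : forall i r, cen i = Some r -> (r.1%:E < r.2)%E ->
  gamma i s = Some r.
Hypothesis gap : 2 * `|s - t| < g.

Lemma center_out_alive i j p q r : gamma i s = Some p -> gamma j t = Some q ->
  cen j = Some r ->
  alv (gamma j t) (p.1 + `|s - t|) = (r.1 <= p.1) && (p.1%:E < r.2)%E.
Proof.
move=> gi gj cj; rewrite gj; have [r' + rq] := cen_close gj; rewrite cj => -[rr].
rewrite -rr in rq; apply: (alive_shift censep (cen_supp gi) cj rq (z := `|s - t|)).
  by rewrite lexx.
by move: gap; lra.
Qed.

Lemma center_in_alive i j p q r : gamma i t = Some q -> cen i = Some r ->
  gamma j s = Some p ->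
  alv (gamma j s) (q.1 + `|s - t|) = (p.1 <= r.1) && (r.1%:E < p.2)%E.
Proof.
move=> gi ci gj; rewrite gj; have [r' + rq] := cen_close gi; rewrite ci => -[rr].
rewrite -{}rr {r'} in rq.
apply: (alive_shift censep ci (cen_supp gj) (points_close_refl _)
  (z := 2 * `|s - t|)).
  by have [+ _ _] := rq; rewrite ler_norml; lra.
by move: gap; lra.
Qed.

(** The first two inequalities come from aliveness at p.1 + |s - t|, the third from
    [tr_matrix_death]; the gap makes them exact for central values. Together they show in particular
    that r is off the diagonal. *)
Lemma center_out A i j p q r : tr_matrix gamma Bs Bt A -> A j i != 0 ->
  gamma i s = Some p -> gamma j t = Some q -> cen j = Some r ->
  [/\ r.1 <= p.1, (p.1%:E < r.2)%E & (r.2 <= p.2)%E].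
Proof.
move=> HA Aji gi gj cj; have [Aa _] := HA.2 i p gi.
have := Aa j Aji; rewrite (center_out_alive gi gj cj) => /andP[-> ->]; split=> //.
have := tr_matrix_death gproper hs ht BsP BtP HA gi gj Aji.
have [r' + rq] := cen_close gj; rewrite cj => -[rr]; rewrite -rr in rq => qp.
apply: (death_shift censep cenfin (cen_supp gi) cj rq (points_close_refl _) qp).
by move: gap; lra.
Qed.

Lemma center_in M i j p q r : tr_matrix gamma Bt Bs M -> M j i != 0 ->
  gamma i t = Some q -> cen i = Some r -> gamma j s = Some p ->
  [/\ p.1 <= r.1, (r.1%:E < p.2)%E & (p.2 <= r.2)%E].
Proof.
move=> HM Mji gi ci gj; have [Ma _] := HM.2 i q gi.
have := Ma j Mji; rewrite distrC (center_in_alive gi ci gj) => /andP[-> ->].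
split=> //.
have := tr_matrix_death gproper ht hs BtP BsP HM gi gj Mji.
have [r' + rq] := cen_close gi; rewrite ci => -[rr]; rewrite -rr distrC in rq => pq.
apply: (death_shift censep cenfin ci (cen_supp gj) (points_close_refl _) rq pq).
by rewrite (distrC t); move: gap; lra.
Qed.

(* The round trip from s to t and back is a transition map, so the diagonal
   entries of the product of the two matrices are 1; only one term of such an
   entry can be nonzero. *)
Lemma center_diag A M i p : tr_matrix gamma Bs Bt A -> tr_matrix gamma Bt Bs M ->
  gamma i s = Some p -> [/\ A i i != 0, M i i != 0 & isSome (gamma i t)].
Proof.
move=> HA HM gi.
have pp : ((p.1 + `|s - t| + `|s - t|)%:E < p.2)%E.
  have := @censep i i p p false true (cen_supp gi) (cen_supp gi) (gproper gi).
  by apply: lt_le_trans; rewrite -EFinD lte_fin; move: gap; lra.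
have [j [q [gj Aji Mij _]]] := tr_matrix_round gproper hs ht BsP BtP HA HM gi pp.
have [r cj _] := cen_close gj.
have [r1 r2 r3] := center_out HA Aji gi gj cj.
have [q1 q2 q3] := center_in HM Mij gj cj gi.
(* The way out gives r <= p and the way back p <= r in both coordinates. *)
have pr : p = r.
  by case: p r r1 r2 r3 q1 q2 q3 {gi pp cj} => [p1 p2] [q1 q2] /= *;
    congr (_, _); apply/le_anti/andP.
have ji : j = i.
  apply: (gsimple (t := s) (p := p) _ gi) => /=; rewrite pr.
  by apply: cen_proper => //; rewrite -pr; apply: gproper gi.
by move: gj Aji Mij; rewrite ji => ->.
Qed.

End Center.

(** * Segments *)

Section Interval.
Variables (F : fieldType) (R : realType) (s0 s1 : R).
Implicit Types (t u c d w v e f : R).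
Variables (V : vineyard_module F s0 s1) (N : nat).
Variable gamma : 'I_N -> R -> option (point R).
Hypothesis gammaV : is_vineyard_of V gamma.
Variables a b : R.
Hypotheses (s0a : s0 <= a) (ab : a < b) (bs1 : b <= s1).
Hypothesis regular : forall t : R, a < t < b -> ~ critical gamma t.
Variable B : forall t : R, ext_family N (V t).
Hypothesis Bbasis : ext_bases gamma a b B.

Ltac slra := move: s0a ab bs1; lra.

Lemma gamma_proper t : proper (gamma ^~ t).
Proof. by move=> i p; have [/(_ i)[_ _ _ H _] _ _] := gammaV; exact: H. Qed.

Lemma gamma_simple t : simple (gamma ^~ t).
Proof. by move=> i j p; have [_ H _] := gammaV; exact: H. Qed.

Lemma coordinate_gt i t p s : gamma i t = Some p -> (-oo < coordinate p s)%E.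
Proof.
move=> /gamma_proper; case: s => [|_] /=; last by rewrite ltNyr.
by apply: lt_trans; rewrite ltNyr.
Qed.

Lemma in_span t : a <= t <= b -> s0 <= t <= s1.
Proof. by move=> ht; slra. Qed.

Lemma supp_inside i t u : a < t < b -> a < u < b ->
  isSome (gamma i t) = isSome (gamma i u).
Proof.
move=> ht hu; have [/(_ i) gi _ _] := gammaV.
apply: (supp_constant gi s0a bs1) => // w hw.
by split=> H; apply: (regular hw); right; exists i; [left|right].
Qed.

Lemma near_inside c d : a <= c <= b -> 0 < d ->
  exists2 u : R, a < u < b & `|u - c| < d.
Proof.
move=> hc d0; pose e := Num.min (d / 2) ((b - a) / 4).
have e0 : 0 < e by rewrite lt_min; slra.
have ed : e <= d / 2 by rewrite ge_min lexx.
have eb : e <= (b - a) / 4 by rewrite ge_min lexx orbT.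
have [cm|mc] := leP c ((a + b) / 2).
  by exists (c + e); [slra|rewrite ltr_norml; slra].
by exists (c - e); [slra|rewrite ltr_norml; slra].
Qed.

Lemma supp_closed i c u : a <= c <= b -> a < u < b -> isSome (gamma i c) ->
  isSome (gamma i u).
Proof.
move=> hc hu; case gc: (gamma i c) => [p|] // _.
have [/(_ i) gi _ _] := gammaV.
have [d d0 H] := vine_continuous gi (in_span hc) gc ltr01.
have [w hw wc] := near_inside hc d0.
have [|q gw _] := H w _ wc; first by apply: in_span; slra.
by rewrite (supp_inside i hu hw) gw.
Qed.

(** A round trip from t to u passes through a vine j whose point at u is within |t - u| of p. If j
    were not i, its point at t would lie within |t - u| + [eta] of p, whereas [eta] is chosen so
    that no other point at t is 2 * [eta]-close to p. *)
Lemma lipschitz_local i t p : a < t < b -> gamma i t = Some p ->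
  exists2 delta : R, 0 < delta & forall u q, a < u < b -> `|u - t| < delta ->
    gamma i u = Some q -> points_close `|t - u| p q.
Proof.
move=> ht gt; have [gv _ _] := gammaV.
have ht' : a <= t <= b by slra.
have [||eta eta0 etaP] := @uniform_delta R 'I_N (fun j e => forall q,
    gamma j t = Some q -> j <> i -> ~ points_close (2 * e) p q).
- move=> j x y y0 yx H q gq ji pq; apply: (H q gq ji).
  by apply: points_close_le pq; slra.
- move=> j; case gj: (gamma j t) => [q|]; last by exists 1.
  have [->|ji] := eqVneq j i; first by exists 1.
  have [|e e0 npq] := @points_far R p q.
    by move=> pq; move/eqP: ji; apply; apply: (gamma_simple (t := t) gj); rewrite -pq.
  exists (e / 2) => [|_ [<-] _]; first by slra.
  by rewrite mulrC divfK.
(* The bar p outlasts any round trip with |t - u| < l. *)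
have [l l0 lP] : exists2 l : R, 0 < l & ((p.1 + l + l)%:E < p.2)%E.
  have := gamma_proper gt; case: p.2 => [d| |] //; last by exists 1; rewrite ?ltry.
  by rewrite lte_fin => pd; exists ((d - p.1) / 4); rewrite ?lte_fin; slra.
have [||d d0 dP] := @uniform_delta R 'I_N (fun j d => forall u q,
    s0 <= u <= s1 -> `|u - t| < d -> gamma j t = Some q ->
    exists2 r, gamma j u = Some r & points_close eta q r).
- by move=> j x y y0 yx H u q hu ut; apply: H => //; slra.
- move=> j; case gj: (gamma j t) => [q|]; last by exists 1.
  have [d d0 H] := vine_continuous (gv j) (in_span ht') gj eta0.
  by exists d => // u _ hu ut [<-]; exact: H.
exists (Num.min d (Num.min eta l)); first by rewrite !lt_min d0 eta0.
move=> u q hu; rewrite !lt_min => /and3P[ud ueta ul] gu.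
have hu' : a <= u <= b by slra.
have [A HA] := tr_matrix_exists (B t) (Bbasis hu').
have [M HM] := tr_matrix_exists (B u) (Bbasis ht').
rewrite distrC in ueta ul.
have [|j [r [gj _ _ pr]]] := tr_matrix_round gamma_proper (in_span ht') (in_span hu')
  (Bbasis ht') (Bbasis hu') HA HM gt.
  apply: le_lt_trans lP; rewrite lee_fin; slra.
suff ji : j = i by move: gj; rewrite ji gu => -[->].
have : isSome (gamma j t) by rewrite (supp_inside j ht hu) gj.
case gjt: (gamma j t) => [w|] // _.
apply: contrapT => ji; apply: (etaP j w gjt ji).
have [r' + wr] := dP j u w (in_span hu') ud gjt; rewrite gj => -[rr].
rewrite -{}rr {r'} in wr.
apply: points_close_le (points_close_trans pr (points_close_sym wr)).
by slra.
Qed.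

Lemma lipschitz_inside i t u p q : a < t < b -> a < u < b ->
  gamma i t = Some p -> gamma i u = Some q -> points_close `|t - u| p q.
Proof.
suff main c d x y : a < c -> c <= d -> d < b -> gamma i c = Some x ->
    gamma i d = Some y -> points_close (d - c) x y.
  move=> ht hu gt gu; have [tu|ut] := leP t u.
    by rewrite distrC ger0_norm ?subr_ge0 //; apply: main gt gu; slra.
  apply: points_close_sym; rewrite ger0_norm ?subr_ge0 ?ltW //.
  by apply: main gu gt; slra.
move=> ac cd db gc gd.
have := @cousin R (fun c d => forall x y, gamma i c = Some x ->
    gamma i d = Some y -> points_close (d - c) x y) c d cd _ _ x y gc gd.
apply.
- move=> w hw; have hw' : a < w < b by slra.
  have hc : a < c < b by slra.
  have := supp_inside i hc hw'; rewrite gc.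
  case gw: (gamma i w) => [z|] // _.
  have [e e0 H] := lipschitz_local hw' gw.
  exists e => // c' d' h1 /andP[h2 h3] h4 h5 x' y' gx gy.
  have zx : points_close `|w - c'| z x'.
    by apply: H => //; [slra|rewrite ltr_norml; slra].
  have zy : points_close `|w - d'| z y'.
    by apply: H => //; [slra|rewrite ltr_norml; slra].
  have := points_close_trans (points_close_sym zx) zy.
  rewrite ger0_norm ?subr_ge0 // distrC ger0_norm ?subr_ge0 //.
  by apply: points_close_le; slra.
- move=> c' d' e' h1 h2 h3 h4 H1 H2 x' z' gx gz.
  have hc : a < c' < b by slra. have hd : a < d' < b by slra.
  have := supp_inside i hc hd; rewrite gx; case gy: (gamma i d') => [y'|] // _.
  apply: points_close_le (points_close_trans (H1 _ _ gx gy) (H2 _ _ gy gz)).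
  by slra.
Qed.

Lemma lipschitz i t u p q : a <= t <= b -> a <= u <= b ->
  gamma i t = Some p -> gamma i u = Some q -> points_close `|t - u| p q.
Proof.
move=> ht hu gt gu; have [gv _ _] := gammaV; apply: points_close_lim => f f0.
(* Both ends are moved to interior times, each at a cost in time and a cost in value. *)
have f4 : 0 < f / 4 by slra.
have approach w r : a <= w <= b -> gamma i w = Some r -> exists w' r',
    [/\ a < w' < b, `|w' - w| < f / 4, gamma i w' = Some r' &
        points_close (f / 4) r r'].
  move=> hw gw; have [d d0 H] := vine_continuous (gv i) (in_span hw) gw f4.
  have m0 : 0 < Num.min d (f / 4) by rewrite lt_min d0.
  have [w' hw'] := near_inside hw m0; rewrite lt_min => /andP[wd wf].
  have [|r' gr rr] := H w' _ wd; first by apply: in_span; slra.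
  by exists w', r'.
have [t' [p' [ht' tt gt' pp]]] := approach t p ht gt.
have [u' [q' [hu' uu gu' qq]]] := approach u q hu gu.
have pq := points_close_trans pp (points_close_trans
  (lipschitz_inside ht' hu' gt' gu') (points_close_sym qq)).
apply: points_close_le pq.
have := ler_distD t t' u'; have := ler_distD u t u'; rewrite (distrC u u'); slra.
Qed.

Definition midtime : R := (a + b) / 2.

Lemma midtimeP : a < midtime < b.
Proof. by rewrite /midtime; slra. Qed.

(* At an endpoint c, a vine which appears or disappears there is continued by
   the point (v, v) at which it meets the diagonal. *)
Lemma limit_point i c : c = a \/ c = b -> exists o : option (point R),
  [/\ isSome o = isSome (gamma i midtime),
      forall t p q, a <= t <= b -> gamma i t = Some p -> o = Some q ->
        points_close `|t - c| q p &
      o = gamma i c \/ [/\ gamma i c = None, (exists v, o = Some (v, v%:E) /\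
        forall s, limit_value gamma c (i, s) v) &
        appears (gamma i) c \/ disappears (gamma i) c]].
Proof.
move=> cab; have hc : a <= c <= b by case: cab => ->; slra.
have hm := midtimeP.
case gc: (gamma i c) => [p|].
  exists (Some p); split; last by left.
    by rewrite (supp_closed hc hm) // gc.
  by move=> t q _ ht gt [<-]; apply: points_close_sym; exact: lipschitz gt gc.
case gm: (gamma i midtime) => [pm|]; last first.
  by exists None; split=> //; left.
have [gv _ _] := gammaV.
(* By the speed bound, each p.1 - |u - c| bounds the limiting birth from below and each p.1 + |u -
   c| from above, so the limit is the supremum of E. *)
pose E := [set x | exists u p, [/\ a <= u <= b, gamma i u = Some p &
                                   x = p.1 - `|u - c|]].
pose v := sup E.
have Eub u p : a <= u <= b -> gamma i u = Some p -> ubound E (p.1 + `|u - c|).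
  move=> hu gu _ [w [q [hw gw ->]]].
  have [+ _ _] := lipschitz hu hw gu gw; rewrite ler_norml.
  have := ler_distD c u w; rewrite (distrC c w); slra.
have Em : E !=set0 by exists (pm.1 - `|midtime - c|), midtime, pm; split=> //; slra.
have vP u p : a <= u <= b -> gamma i u = Some p -> `|v - p.1| <= `|u - c|.
  move=> hu gu; have v1 : v <= p.1 + `|u - c| by apply: ge_sup => //; exact: Eub.
  have v2 : p.1 - `|u - c| <= v.
    by apply: ub_le_sup; [exists (p.1 + `|u - c|); exact: Eub|exists u, p].
  by rewrite ler_norml; slra.
have close t p : a <= t <= b -> gamma i t = Some p ->
    points_close `|t - c| (v, v%:E) p.
  move=> ht gt; split=> /=; first exact: vP.
    have pp := gamma_proper gt.
    have : (v%:E <= (p.1 + `|t - c|)%:E)%E.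
      by rewrite lee_fin; have := vP t p ht gt; rewrite ler_norml; slra.
    by move=> H; apply: (le_trans H); rewrite EFinD leeD2r // ltW.
  (* The upper bound on the death of p goes through a time u close to c, where the point is nearly
     diagonal and its death is controlled by its birth. *)
  apply/lee_addgt0Pr => f f0; have f8 : 0 < f / 8 by slra.
  have [d d0 H] := vine_near_diagonal (gv i) (in_span hc) gc f8.
  have m0 : 0 < Num.min d (f / 8) by rewrite lt_min d0.
  have [u hu] := near_inside hc m0; rewrite lt_min => /andP[ud uf].
  have hu' : a <= u <= b by slra.
  have := supp_inside i hm hu; rewrite gm; case gu: (gamma i u) => [r|] // _.
  have := H u r (in_span hu') ud gu; rewrite /near_diagonal => r2.
  have [_ + _] := lipschitz ht hu' gt gu => pr.
  apply: (le_trans pr); apply: (le_trans (leeD2r _ r2)).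
  rewrite -!EFinD lee_fin; have := vP u r hu' gu; rewrite ler_norml.
  have := ler_distD c t u; rewrite (distrC c u); slra.
have app : appears (gamma i) c \/ disappears (gamma i) c.
  have ns : ~ supp (gamma i) c by rewrite /supp /= gc.
  case: cab => ec; [left|right]; split=> //; exists (b - a); rewrite ?subr_gt0 // => u hu;
  by rewrite /supp /= (supp_inside i (u := midtime)) ?gm //; rewrite ec in hu; slra.
exists (Some (v, v%:E)); split=> //; first by move=> t p q ht gt [<-]; exact: close.
right; split=> //; exists v; split=> // s; split=> //=.
have [_ _ itv _ _] := gv i.
(* [limit_value] runs over the whole support, possibly beyond the segment. As the support is an
   interval that misses c, near c it lies on the side of [a, b]. *)
have inside u : supp (gamma i) u -> `|u - c| < b - a -> a <= u <= b.
  move=> su; rewrite ltr_norml => uc.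
  have sm : supp (gamma i) midtime by rewrite /supp /= gm.
  have nc : ~ supp (gamma i) c by rewrite /supp /= gc.
  case: cab => ec; rewrite ec in uc nc; apply/andP; split; try slra.
    by rewrite leNgt; apply/negP => ua; apply: nc; apply: (itv u midtime su sm); slra.
  by rewrite leNgt; apply/negP => ua; apply: nc; apply: (itv midtime u sm su); slra.
have closeC u : supp (gamma i) u -> `|u - c| < b - a ->
    [/\ coordinate (odflt (0, 0%E) (gamma i u)) s \is a fin_num &
        `|v - fine (coordinate (odflt (0, 0%E) (gamma i u)) s)| <= `|u - c|].
  move=> su uc; have hu := inside u su uc.
  move: su; rewrite /supp /=; case gu: (gamma i u) => [p|] // _ /=.
  have /points_closeP/(_ s)[] := close u p hu gu.
  have -> : coordinate ((v, v%:E) : point R) s = v%:E by case: s.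
  case: (coordinate p s) => [x| |] //=; rewrite -!EFinD !lee_fin => h1 h2.
  by split=> //; rewrite ler_norml; slra.
have near_c (e : R) : 0 < e -> \forall u \near c, `|u - c| < e.
  by move=> e0; exists e => //= u; rewrite /ball /= distrC.
have ba0 : 0 < b - a by rewrite subr_gt0.
apply/fine_cvgP; split.
  rewrite near_withinE; apply: filterS (near_c _ ba0) => u uc su.
  by have [] := closeC u su uc.
apply/cvgrPdist_lt => e e0; rewrite near_withinE.
apply: filterS2 (near_c _ ba0) (near_c _ e0) => u uc ue su.
by have [_ H] := closeC u su uc; apply: (le_lt_trans H).
Qed.

Lemma regular_eq u i j s s' p q : ~ critical gamma u -> gamma i u = Some p ->
  gamma j u = Some q -> coordinate p s = coordinate q s' ->
  (i, s) = (j, s') \/ coordinate p s = +oo%E.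
Proof.
move=> nc gi gj pq; have := coordinate_gt s gi.
case Ep: (coordinate p s) => [v| |] // _; last by right.
left; apply: contrapT => /eqP ne; apply: nc; left.
exists (i, s), (j, s'), v; split=> //; first by exists p.
by exists q => //=; rewrite -pq.
Qed.

(** With g the gap at u, delta is g / 8: two shifts below delta and the margin 4 * delta stay below
    g. *)
Lemma regular_order u : a <= u <= b -> exists2 delta : R, 0 < delta &
  forall t, a <= t <= b -> `|u - t| < delta ->
  forall i j s s' p q p' q', gamma i u = Some p -> gamma j u = Some q ->
    gamma i t = Some p' -> gamma j t = Some q' ->
    (coordinate p s < coordinate q s')%E ->
    (coordinate p' s + (4 * delta)%:E < coordinate q' s')%E.
Proof.
move=> hu; have [i p s gi|g g0 gsep] := @sep_exists R N (gamma ^~ u).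
  exact: coordinate_gt gi.
exists (g / 8) => [|t ht ut i j s s' p q p' q' gi gj gi' gj' pq]; first by slra.
have /points_closeP/(_ s)[_ cp] := lipschitz hu ht gi gi'.
have /points_closeP/(_ s')[cq _] := lipschitz hu ht gj gj'.
apply: (lt_shift (coordinate_gt s gi) pq (gsep _ _ _ _ _ _ gi gj pq) cp cq).
by slra.
Qed.

(** Values distinct at u stay apart by [regular_order]; at a regular time, equal values belong to
    the same label or are infinite, and then they stay equal. *)
Lemma regular_sep u : a <= u <= b -> ~ critical gamma u ->
  exists2 delta : R, 0 < delta & forall t, a <= t <= b -> `|u - t| < delta ->
    (forall i, isSome (gamma i t) = isSome (gamma i u)) ->
    sep (4 * delta) (gamma ^~ t).
Proof.
move=> hu nc; have [d d0 H] := regular_order hu; exists d => // t ht ut St.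
move=> i j p' q' s s' gi' gj' pq'.
have := St i; rewrite gi'; case gi: (gamma i u) => [p|] // _.
have := St j; rewrite gj'; case gj: (gamma j u) => [q|] // _.
have [pq|qp|pq] := ltgtP (coordinate p s) (coordinate q s').
- by apply/ltW/(H t ht ut i j s s' p q).
- have := H t ht ut j i s' s q p _ _ gj gi gj' gi' qp => qp'.
  have : (coordinate q' s' <= coordinate p' s)%E.
    apply: le_trans (ltW qp'); rewrite leeDl // lee_fin; slra.
  by rewrite leNgt pq'.
- have [[ij ss]|poo] := regular_eq nc gi gj pq.
    by move: pq'; rewrite ss -ij in gj' *; move: gj'; rewrite gi' => -[->]; rewrite ltxx.
  have /points_closeP/(_ s)[+ _] := lipschitz hu ht gi gi'.
  rewrite poo; move: pq'; case: (coordinate p' s) => [x| |] //.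
  by rewrite ltNge leey.
Qed.

(** A basis at time t is encoded by a matrix acting on B t, so that a family of bases is a function
    into one fixed type, as the lifting lemmas require. *)
Definition fam (C : 'M[F]_N) t : ext_family N (V t) := mx_act C (B t).

(** The relation to be lifted along time: elements with the same index correspond under [tr]. Since
    both families must be bases, [transported t t C C] expresses that C is admissible at t. *)
Definition transported s t (C C' : 'M[F]_N) :=
  [/\ is_ext_basis (gamma ^~ s) (fam C s), is_ext_basis (gamma ^~ t) (fam C' t) &
      forall i p, gamma i s = Some p ->
        tr V s p.1 t (p.1 + `|s - t|) (elt (fam C s i) p.1) =
        elt (fam C' t i) (p.1 + `|s - t|)].

Lemma transported_refl t C : a <= t <= b -> is_ext_basis (gamma ^~ t) (fam C t) ->
  transported t t C C.
Proof.
move=> ht Cb; split=> // i p gi; rewrite subrr normr0 addr0.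
by rewrite tr_phi ?(elt_phi Cb gi) //; exact: in_span.
Qed.

Lemma birth_lipschitz i t u p q : a <= t <= b -> a <= u <= b ->
  gamma i t = Some p -> gamma i u = Some q -> q.1 <= p.1 + `|t - u|.
Proof.
by move=> ht hu gt gu; have [+ _ _] := lipschitz ht hu gt gu; rewrite ler_norml; slra.
Qed.

Lemma transported_push s t C C' i p g H : a <= s <= b -> a <= t <= b ->
  transported s t C C' -> gamma i s = Some p -> isSome (gamma i t) ->
  p.1 <= g -> g + `|s - t| <= H ->
  tr V s g t H (elt (fam C s i) g) = elt (fam C' t i) H.
Proof.
move=> hs ht [Cb Cb' E] gi; case gi': (gamma i t) => [q|] // _ pg gH.
have pH : p.1 + `|s - t| <= H by slra.
rewrite -(elt_phi Cb gi (lexx _) pg) tr_phi_l //; try exact: in_span.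
rewrite -(tr_phi_r _ (in_span hs) (in_span ht) (lexx _) pH) E //.
by rewrite (elt_phi Cb' gi') //; exact: birth_lipschitz gi gi'.
Qed.

(** * Propagation of bases over regular times *)

Section RegularTimes.
Variable J : R -> Prop.
Hypothesis J_ab : forall t, J t -> a <= t <= b.
Hypothesis J_supp : forall i t u, J t -> J u ->
  isSome (gamma i t) = isSome (gamma i u).
Hypothesis J_regular : forall t, J t -> ~ critical gamma t.

Lemma transported_trans r s t C D E : J r -> J s -> J t ->
  (r <= s <= t \/ t <= s <= r) -> transported r s C D -> transported s t D E ->
  transported r t C E.
Proof.
move=> Jr Js Jt rst CD DE; have [Cb Db _] := CD; have [_ Eb _] := DE.
split=> // i p gi.
have hr := J_ab Jr; have hs := J_ab Js; have ht := J_ab Jt.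
have := J_supp i Jr Js; rewrite gi; case gs: (gamma i s) => [q|] // _.
have := J_supp i Jr Jt; rewrite gi; case gt: (gamma i t) => [w|] // _.
have rE : `|r - t| = `|r - s| + `|s - t|.
  case: rst => /andP[h1 h2].
    by rewrite !ler0_norm ?subr_le0 ?(le_trans h1 h2) //; slra.
  by rewrite !ger0_norm ?subr_ge0 ?(le_trans h1 h2) //; slra.
have e1 : p.1 + `|r - s| + `|s - t| <= p.1 + `|r - t| by slra.
rewrite -(tr_comp _ (in_span hr) (in_span hs) (in_span ht) (lexx _) e1).
rewrite (transported_push hr hs CD gi) ?gs //.
by rewrite (transported_push hs ht DE gs) ?gt //; exact: birth_lipschitz gi gs.
Qed.

(* All maps between nearby regular times are isomorphisms up to elements which
   die long after the births concerned, so a basis at one time determines a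
   coherent family of bases. *)
Lemma transport_local u : J u -> exists2 delta : R, 0 < delta & forall c d,
  (forall t, c <= t <= d -> J t) -> c <= u <= d -> d - c < delta ->
  forall w C, w = c \/ w = d -> transported w w C C ->
  exists f : R -> 'M[F]_N, f w = C /\
    forall s t, c <= s <= d -> c <= t <= d -> transported s t (f s) (f t).
Proof.
move=> Ju; have [de de0 Hsep] := regular_sep (J_ab Ju) (J_regular Ju).
exists de => // c d Jcd cud cd w C wcd Cww.
have Jw : J w by apply: Jcd; case: wcd => ->; slra.
have hw := J_ab Jw; have [Cb _ _] := Cww.
have gsep t : c <= t <= d -> sep (4 * de) (gamma ^~ t).
  move=> ht; apply: Hsep; first exact/J_ab/Jcd.
    by rewrite ltr_norml; slra.
  by move=> i; apply: J_supp => //; exact: Jcd.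
have dist2 s t : c <= s <= d -> c <= t <= d ->
    `|w - t| + `|w - s| + `|s - t| <= 2 * (d - c).
  move=> h1 h2; case: wcd => ->.
    rewrite (@ler0_norm _ (c - t)) ?(@ler0_norm _ (c - s)); try slra.
    by case: (ger0P (s - t)); slra.
  rewrite (@ger0_norm _ (d - t)) ?(@ger0_norm _ (d - s)); try slra.
  by case: (ger0P (s - t)); slra.
have dist1 t : c <= t <= d -> 2 * `|t - w| < 4 * de.
  move=> h; have := dist2 t t h h; rewrite (distrC t w) subrr normr0; slra.
(* [M t] expresses the basis at w, carried to time t, in B t. Taking t itself as centre, its diagram
   being separated by 4 * [de], shows that [M t] is triangular with nonzero diagonal. *)
have /choice[M MP] : forall t, exists M, c <= t <= d ->
    tr_matrix gamma (fam C w) (B t) M.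
  move=> t; have [ht|nt] := boolP (c <= t <= d); last by exists 0.
  by have [M HM] := tr_matrix_exists (fam C w) (Bbasis (J_ab (Jcd t ht))); exists M.
have MD t i j p q : c <= t <= d -> gamma i t = Some p -> gamma j t = Some q ->
    M t j i != 0 -> ple q p.
  move=> ht gi gj Mji; have Jt := Jcd t ht.
  have := J_supp i Jw Jt; rewrite gi; case gw: (gamma i w) => [r|] // _.
  have [| | |q1 _ q2] := center_in (s := t) (t := w) gamma_proper (in_span (J_ab Jt))
    (in_span hw) (Bbasis (J_ab Jt)) Cb (gsep t ht) _ _ _ (dist1 t ht) (MP t ht)
    Mji gw gi gj.
  - by move=> k x s; exact: coordinate_gt.
  - by [].
  - move=> k x gk; have := J_supp k Jw Jt; rewrite gk.
    case gk': (gamma k t) => [y|] // _; exists y => //.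
    exact: lipschitz (J_ab Jt) hw gk' gk.
  by rewrite /ple q1 q2.
have Mdiag t i : c <= t <= d -> gamma i t -> M t i i != 0.
  move=> ht; case gi: (gamma i t) => [p|] // _; have Jt := J_ab (Jcd t ht).
  have [A HA] := tr_matrix_exists (B t) Cb.
  have [| | | |_ ? _] := center_diag gamma_proper gamma_simple (in_span Jt)
    (in_span hw) (Bbasis Jt) Cb (gsep t ht) _ _ _ _ (dist1 t ht) HA (MP t ht) gi.
  - by move=> k x s; exact: coordinate_gt.
  - by [].
  - move=> k x gk; have := J_supp k Jw (Jcd t ht); rewrite gk.
    case gk': (gamma k t) => [y|] // _; exists y => //.
    exact: lipschitz Jt hw gk' gk.
  - by [].
  - by [].
have Mb t : c <= t <= d -> is_ext_basis (gamma ^~ t) (fam (M t) t).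
  move=> ht; apply: (tri_ext_basis (Bbasis (J_ab (Jcd t ht)))).
  - exact: gamma_proper.
  - exact: gamma_simple.
  - by move=> i j p q; exact: MD.
  - by move=> i; exact: Mdiag.
pose f t := if t == w then C else M t.
have fw : f w = C by rewrite /f eqxx.
have fP t : c <= t <= d -> transported w t C (f t).
  move=> ht; rewrite /f; case: eqP => [->//|_]; have Jt := J_ab (Jcd t ht).
  split=> // [|i p gi]; first exact: Mb.
  have [_ ->] := (MP t ht).2 i p gi.
  have := J_supp i Jw (Jcd t ht); rewrite gi; case gt: (gamma i t) => [q|] // _.
  rewrite (elt_mx_act (Bbasis Jt) _ gt) //.
    by move=> i' j' p' q'; exact: MD.
  exact: birth_lipschitz gi gt.
exists f; split=> // s t hs ht.
have [_ sb _] := fP s hs; have [_ tb _] := fP t ht; split=> // i p gi.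
have Js := J_ab (Jcd s hs); have Jt := J_ab (Jcd t ht).
have := J_supp i (Jcd s hs) Jw; rewrite gi; case gw: (gamma i w) => [r|] // _.
have := J_supp i (Jcd s hs) (Jcd t ht); rewrite gi.
case gt: (gamma i t) => [q|] // _.
have pr := birth_lipschitz hw Js gw gi; have rq := birth_lipschitz Jt hw gt gw.
have qp := birth_lipschitz Js Jt gi gt.
rewrite (distrC t) in rq.
(* The map from s to t is compared with transport from w only at H, where the element at s is the
   image of one at w. Nothing alive at h dies by H, since H exceeds the birth q.1 by at most 2 * (d
   - c), which is below the separation at t. *)
pose h := p.1 + `|s - t|; pose H := r.1 + `|w - s| + `|s - t|.
have hH : h <= H by rewrite /h /H; slra.
apply: (phi_injective tb hH) => [j y gj hy|].
  have qy : (coordinate q false < coordinate y true)%E.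
    by apply: le_lt_trans hy; rewrite lee_fin.
  apply: lt_le_trans (gsep t ht _ _ _ _ _ _ gt gj qy).
  rewrite -EFinD lte_fin /H; have := dist2 s t hs ht; slra.
rewrite (elt_phi tb gt qp hH) tr_phi_r //; try exact: in_span.
rewrite -(tr_phi_l (g := r.1 + `|w - s|) _ (in_span Js) (in_span Jt)) ?lexx //.
rewrite (elt_phi sb gi (lexx _) pr).
rewrite -(transported_push hw Js (fP s hs) gw _ (lexx _) (lexx _)) ?gi //.
rewrite tr_comp ?lexx //; try exact: in_span.
have := transported_push hw Jt (fP t ht) gw _ (lexx _) (H := H); rewrite gt; apply=> //.
by rewrite /H -addrA lerD2l ler_distD.
Qed.

End RegularTimes.

Lemma supp_regular_right i t u : ~ critical gamma b -> a < t <= b ->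
  a < u <= b -> isSome (gamma i t) = isSome (gamma i u).
Proof.
move=> nb; suff main v : a < v <= b ->
    isSome (gamma i v) = isSome (gamma i midtime) by move=> ht hu; rewrite !main.
have hm := midtimeP; move=> /andP[av]; rewrite le_eqVlt => /orP[/eqP ->|vb].
  case gb: (isSome (gamma i b)).
    by rewrite (@supp_closed i b) //; slra.
  apply/esym/negbTE/negP => gm; apply: nb; right; exists i; right.
  split; first by rewrite /supp /= gb.
  exists (b - a) => [|w hw]; first by slra.
  by rewrite /supp /= (supp_inside i (u := midtime)) //; slra.
by apply: supp_inside; slra.
Qed.

Lemma supp_regular_left i t u : ~ critical gamma a -> a <= t < b ->
  a <= u < b -> isSome (gamma i t) = isSome (gamma i u).
Proof.
move=> na; suff main v : a <= v < b ->
    isSome (gamma i v) = isSome (gamma i midtime) by move=> ht hu; rewrite !main.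
have hm := midtimeP; move=> /andP[]; rewrite le_eqVlt => /orP[/eqP <- _|av vb].
  case ga: (isSome (gamma i a)).
    by rewrite (@supp_closed i a) //; slra.
  apply/esym/negbTE/negP => gm; apply: na; right; exists i; left.
  split; first by rewrite /supp /= ga.
  exists (b - a) => [|w hw]; first by slra.
  by rewrite /supp /= (supp_inside i (u := midtime)) //; slra.
by apply: supp_inside; slra.
Qed.

Lemma transport_left C : ~ critical gamma b ->
  is_ext_basis (gamma ^~ b) (fam C b) -> exists f : R -> 'M[F]_N, f b = C /\
    forall s t, a < s <= b -> a < t <= b -> transported s t (f s) (f t).
Proof.
move=> nb Cb; pose J (t : R) := is_true (a < t <= b).
have Jab t : J t -> a <= t <= b by rewrite /J; slra.
have Jsupp i t u : J t -> J u -> isSome (gamma i t) = isSome (gamma i u).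
  exact: supp_regular_right.
have Jreg t : J t -> ~ critical gamma t.
  move=> /andP[at_]; rewrite le_eqVlt => /orP[/eqP ->//|tb].
  by apply: regular; rewrite at_.
apply: (path_lift_left (rel := transported)) => //.
- move=> r s t x y z hr hs ht; exact: (transported_trans Jab Jsupp).
- move=> u hu; have [d d0 H] := transport_local Jab Jsupp Jreg hu.
  exists d => // c1 d1 h1 h2 h3 h4; apply: (H c1 d1) => // t ht.
  by rewrite /J; slra.
- by apply: transported_refl => //; slra.
Qed.

Lemma transport_right C : ~ critical gamma a ->
  is_ext_basis (gamma ^~ a) (fam C a) -> exists f : R -> 'M[F]_N, f a = C /\
    forall s t, a <= s < b -> a <= t < b -> transported s t (f s) (f t).
Proof.
move=> na Ca; pose J (t : R) := is_true (a <= t < b).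
have Jab t : J t -> a <= t <= b by rewrite /J; slra.
have Jsupp i t u : J t -> J u -> isSome (gamma i t) = isSome (gamma i u).
  exact: supp_regular_left.
have Jreg t : J t -> ~ critical gamma t.
  move=> /andP[]; rewrite le_eqVlt => /orP[/eqP <-//|at_ tb].
  by apply: regular; rewrite at_.
apply: (path_lift_right (rel := transported)) => //.
- move=> r s t x y z hr hs ht; exact: (transported_trans Jab Jsupp).
- move=> u hu; have [d d0 H] := transport_local Jab Jsupp Jreg hu.
  exists d => // c1 d1 h1 h2 h3 h4; apply: (H c1 d1) => // t ht.
  by rewrite /J; slra.
- by apply: transported_refl => //; slra.
Qed.

Lemma pi_mxE (S : {set 'I_N}) j i :
  (pi_mx F S) j i = ((j == i) && (i \in S))%:R.
Proof.
by rewrite !mxE; case: (eqVneq j i) => [->|]; rewrite ?mulr1n ?mulr0n.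
Qed.

Lemma sum_pi_mx X (x : 'I_N -> option {h : R & (X : persmod F R) h})
    (S : {set 'I_N}) i h : i \in S ->
  \sum_(j < N) (pi_mx F S) j i *: elt (x j) h = elt (x i) h.
Proof.
by move=> iS; rewrite [RHS]elt_delta; apply: eq_bigr => j _; rewrite pi_mxE iS andbT.
Qed.

Lemma transported_Mat (f : R -> 'M[F]_N) (J : R -> Prop) u :
  (forall t, J t -> a <= t <= b) ->
  (forall i t v, J t -> J v -> isSome (gamma i t) = isSome (gamma i v)) ->
  (forall t v, J t -> J v -> transported t v (f t) (f v)) -> J u ->
  exists2 delta : R, 0 < delta & forall s t, J s -> J t -> s < t ->
    u = s \/ u = t -> `|s - t| < delta ->
    Mat (fam (f s) s) (fam (f t) t) (alpha V s t) =
    pi_mx F (S_ gamma s :&: S_ gamma t).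
Proof.
move=> Jab Jsupp Jf Ju.
(* A diagonal entry of [Mat] is 1 only if the target is alive at p.1 + |s - t|. Bars at u longer
   than 2 * d guarantee this for |s - t| < d, whichever of s and t is u. *)
have [||d d0 dP] := @uniform_delta R 'I_N (fun i d => forall p,
    gamma i u = Some p -> ((p.1 + 2 * d)%:E < p.2)%E).
- move=> i x y y0 yx H p gp; apply: le_lt_trans (H p gp).
  by rewrite lee_fin; slra.
- move=> i; case gi: (gamma i u) => [p|]; last by exists 1.
  have := gamma_proper gi; case Ep: p.2 => [x| |] //.
    rewrite lte_fin => px; exists ((x - p.1) / 4); first by slra.
    by move=> _ [<-]; rewrite Ep lte_fin; slra.
  by move=> _; exists 1 => // _ [<-]; rewrite Ep ltry.
exists d => // s t Js Jt st ust std.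
have [sb tb E] := Jf s t Js Jt; have hs := Jab s Js; have ht := Jab t Jt.
apply: (Mat_tr_matrix (in_span hs) (in_span ht) sb tb st); split.
  by move=> i j gi; rewrite pi_mxE !inE gi /= andbF.
move=> i p gi; have := Jsupp i s t Js Jt; rewrite gi.
case gt: (gamma i t) => [q|] // _.
have iS : i \in S_ gamma s :&: S_ gamma t by rewrite !inE gi gt.
split=> [j|]; last by rewrite sum_pi_mx //; exact: E.
rewrite pi_mxE iS andbT; case: (eqVneq j i) => [->|]; last by rewrite eqxx.
move=> _; rewrite gt /= (birth_lipschitz hs ht gi gt) /=.
have [pq pq2 _] := lipschitz hs ht gi gt.
case: ust => ?; subst u.
  have := dP i p gi; move: pq2; case: p.2 => [x| |] //; case: q.2 => [y| |] //;
  by rewrite -?EFinD ?lee_fin ?lte_fin ?ltry //; slra.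
apply: le_lt_trans (dP i q gt); rewrite lee_fin.
by move: pq; rewrite ler_norml; slra.
Qed.

(** * The completed diagram at an endpoint *)

Section Endpoint.
Variables (c : R) (cen : 'I_N -> option (point R)).

Definition center_at :=
  [/\ forall i, isSome (cen i) = isSome (gamma i midtime),
      forall i t p q, a <= t <= b -> gamma i t = Some p -> cen i = Some q ->
        points_close `|t - c| q p &
      forall i, cen i = gamma i c \/
        [/\ gamma i c = None, (exists v, cen i = Some (v, v%:E) /\
          forall s, limit_value gamma c (i, s) v) &
          appears (gamma i) c \/ disappears (gamma i) c]].

Hypothesis center_atP : center_at.

Lemma cen_supp i p : gamma i c = Some p -> cen i = Some p.
Proof.
by move=> gi; have [_ _ /(_ i)[->//|[]]] := center_atP; rewrite gi.
Qed.

Lemma cen_some i t q : a <= t <= b -> gamma i t = Some q ->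
  exists2 r, cen i = Some r & points_close `|c - t| r q.
Proof.
move=> ht gt; have [c1 c2 _] := center_atP.
have : isSome (cen i) by rewrite c1 (supp_closed ht midtimeP) // gt.
case ci: (cen i) => [r|] // _; exists r => //.
by rewrite distrC; exact: c2 gt ci.
Qed.

Lemma cen_fin i p s : cen i = Some p -> (-oo < coordinate p s)%E.
Proof.
have [_ _ /(_ i)[->|[_ [v [-> _]] _] [<-]]] := center_atP.
  exact: coordinate_gt.
by case: s; rewrite /= ltNyr.
Qed.

Lemma cen_proper i r : cen i = Some r -> (r.1%:E < r.2)%E -> gamma i c = Some r.
Proof.
have [_ _ /(_ i)[->//|[_ [v [-> _]] _] [<-]]] := center_atP.
by rewrite /= ltxx.
Qed.

Lemma cen_height i p s v : cen i = Some p -> coordinate p s = v%:E ->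
  critical_height gamma c (i, s) v.
Proof.
have [_ _ /(_ i)[->|[_ [w [-> lw]] _] [<-]]] := center_atP.
  by move=> gi pv; left; exists p.
move=> pv; right; have -> : v = w; last exact: lw.
by move: pv; case: s => -[].
Qed.

Lemma cen_coincide i j p q s s' : cen i = Some p -> cen j = Some q ->
  (i, s) != (j, s') -> coordinate p s = coordinate q s' ->
  coincide gamma c (i, s) (j, s') \/ coordinate p s = +oo%E.
Proof.
move=> ci cj ne pq; have := cen_fin s ci.
case Ep: (coordinate p s) => [v| |] // _; last by right.
left; split=> //; exists v; first exact: cen_height ci Ep.
by apply: cen_height cj _; rewrite -pq.
Qed.

(** A vine missing at c makes its own birth and death coincide there, which uses up the one
    coincidence allowed at c; it therefore cannot occur together with a reversed pair of vines. *)
Lemma cen_absent i p : cen i = Some p -> gamma i c = None ->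
  p.2 = p.1%:E /\ coincide gamma c (i, false) (i, true).
Proof.
have [_ _ /(_ i)[->|[_ [v [-> lv]] _] [<-] _]] := center_atP; first by move=> ->.
split=> //; split; first by apply/eqP => -[].
by exists v; right; exact: lv.
Qed.

Lemma cen_sep : (`|a - b|%:E <= min_gap gamma c * 4^-1%:E)%E ->
  sep (4 * `|a - b|) cen.
Proof.
move=> gap i j p q s s' ci cj pq; have := cen_fin s ci; move: pq.
case Ep: (coordinate p s) => [v| |] //; last by rewrite ltNge leey.
case Eq: (coordinate q s') => [w| |] // pq _; last by rewrite leey.
rewrite lte_fin in pq; have vw : (min_gap gamma c <= `|v - w|%:E)%E.
  apply: ereal_inf_lbound; exists v, w; split=> //.
  - by rewrite lt_eqF.
  - by exists (i, s); exact: cen_height ci Ep.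
  - by exists (j, s'); exact: cen_height cj Eq.
have : (`|a - b|%:E <= `|v - w|%:E * 4^-1%:E)%E.
  by apply: (le_trans gap); apply: lee_wpmul2r => //; rewrite lee_fin invr_ge0 ler0n.
by rewrite -EFinM lee_fin -EFinD lee_fin (@ltr0_norm _ (v - w)) ?subr_lt0 //; slra.
Qed.

End Endpoint.

Lemma center_exists c : c = a \/ c = b -> exists cen, center_at c cen.
Proof.
move=> cab; have /choice[cen cenP] : forall i, _ := fun i => limit_point i cab.
by exists cen; split=> i; have [] := cenP i.
Qed.

Lemma coincide_critical c k k' : coincide gamma c k k' -> critical gamma c.
Proof.
move=> [ne [v [b1|[l1 _]]]]; last by move=> _; right; exists k.1.
move=> [b2|[l2 _]]; last by right; exists k'.1.
by left; exists k, k', v.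
Qed.

Lemma infinite_stays i t u p q s : a <= t <= b -> a <= u <= b ->
  gamma i t = Some p -> gamma i u = Some q -> coordinate p s = +oo%E ->
  coordinate q s = +oo%E.
Proof.
move=> ht hu gt gu po; have /points_closeP/(_ s)[+ _] := lipschitz ht hu gt gu.
by rewrite po; case: (coordinate q s).
Qed.

(** A strict inequality between births or deaths at a persists for a while, and infinite deaths stay
    infinite, so the order can only be lost through an equality of finite heights. *)
Lemma incompatible_coincide k l : forwards_incompatible_by gamma a k l ->
  k != l /\ exists s, coincide gamma a (l, s) (k, s).
Proof.
move=> [[p [q [gl gk pq1 pq2]]] [d d0 H]].
have ha : a <= a <= b by slra.
have [e e0 order] := regular_order ha.
have m0 : 0 < Num.min d e by rewrite lt_min d0.
have [u hu] := near_inside ha m0; rewrite lt_min => /andP[ud ue].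
rewrite distrC in ue.
have hu' : a <= u <= b by slra.
have := @supp_closed l a u ha hu; rewrite gl => /(_ isT).
case gl': (gamma l u) => [p'|] // _.
have := @supp_closed k a u ha hu; rewrite gk => /(_ isT).
case gk': (gamma k u) => [q'|] // _.
have nle : ~ vine_le (gamma l) (gamma k) u.
  by apply: H; move: ud; rewrite ltr_norml; slra.
apply: contrapT => nc; apply: nle.
suff le s : (coordinate p' s <= coordinate q' s)%E.
  by exists p', q'; split=> //; [have := le false; rewrite lee_fin|exact: le true].
have [kl|kl] := eqVneq k l; first by move: gk'; rewrite kl gl' => -[->].
have : (coordinate p s <= coordinate q s)%E by case: s; rewrite /= ?lee_fin.
rewrite le_eqVlt => /orP[/eqP pq|pq]; last first.
  have := order u hu' ue l k s s _ _ _ _ gl gk gl' gk' pq => /ltW.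
  by apply: le_trans; rewrite leeDl // lee_fin; slra.
have := coordinate_gt s gl; case Ep: (coordinate p s) => [v| |] // _.
  case: nc; split=> //; exists s; split; first by apply/eqP => -[/esym/eqP]; apply/negP.
  exists v; first by left; exists p.
  by left; exists q; rewrite //= -pq.
by rewrite (infinite_stays ha hu' gk gk') ?leey // -pq.
Qed.

Let aab : a <= a <= b. Proof. by slra. Qed.
Let bab : a <= b <= b. Proof. by slra. Qed.
Let A : 'M[F]_N := Mat (B a) (B b) (alpha V a b).

Lemma end_matrix : tr_matrix gamma (B a) (B b) A.
Proof.
exact: (tr_matrix_Mat (in_span aab) (in_span bab) (Bbasis aab) (Bbasis bab) ab).
Qed.

Lemma fill_diag_eq i j : A i i != 0 -> fill_diag A j i = A j i.
Proof.
rewrite mxE; case: (eqVneq j i) => [->|_ _]; last by rewrite addr0.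
by move=> /negbTE ->; rewrite addr0.
Qed.

Lemma fill_diag_neq0 i j : fill_diag A j i != 0 -> j = i \/ A j i != 0.
Proof.
rewrite mxE; case: (eqVneq j i) => [->|_]; first by left.
by rewrite addr0; right.
Qed.

Lemma fill_diag_diag i : fill_diag A i i != 0.
Proof.
by rewrite mxE eqxx; case: (eqVneq (A i i) 0) => [->|]; rewrite ?add0r ?oner_neq0 ?addr0.
Qed.

(** * Segments compared with the diagram at the left endpoint *)

Section LeftCentered.
Hypothesis b_regular : ~ critical gamma b.

(** Heights of distinct vines never meet at a regular time unless both are infinite, so each
    comparison is locally constant on the interval (a, b]. *)
Lemma le_persists i j s t t' p q p' q' : a < t <= b -> a < t' <= b ->
  gamma i t = Some p -> gamma j t = Some q ->
  gamma i t' = Some p' -> gamma j t' = Some q' ->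
  (coordinate q s <= coordinate p s)%E = (coordinate q' s <= coordinate p' s)%E.
Proof.
suff main c d x y x' y' : a < c -> c <= d -> d <= b ->
    gamma i c = Some x -> gamma j c = Some y ->
    gamma i d = Some x' -> gamma j d = Some y' ->
    (coordinate y s <= coordinate x s)%E = (coordinate y' s <= coordinate x' s)%E.
  move=> ht ht' gi gj gi' gj'; have [tt|tt] := leP t t'.
    by apply: main gi gj gi' gj' => //; slra.
  by apply/esym; apply: main gi' gj' gi gj => //; slra.
move=> ac cd db gi gj gi' gj'.
have := @cousin R (fun c d => forall x y x' y',
    gamma i c = Some x -> gamma j c = Some y ->
    gamma i d = Some x' -> gamma j d = Some y' ->
    (coordinate y s <= coordinate x s)%E = (coordinate y' s <= coordinate x' s)%E)
  c d cd _ _ _ _ _ _ gi gj gi' gj'.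
have wd k u v : a < u <= b -> a < v <= b -> isSome (gamma k u) -> isSome (gamma k v).
  by move=> hu hv; rewrite (supp_regular_right k b_regular hu hv).
apply => [w hw|c1 c2 c3 h1 h2 h3 h4 H1 H2 z1 z2 z3 z4 g1 g2 g3 g4]; last first.
  have hc1 : a < c1 <= b by slra. have hc2 : a < c2 <= b by slra.
  have := wd i c1 c2 hc1 hc2; rewrite g1 => /(_ isT).
  case gi2: (gamma i c2) => [y1|] // _.
  have := wd j c1 c2 hc1 hc2; rewrite g2 => /(_ isT).
  case gj2: (gamma j c2) => [y2|] // _.
  by rewrite (H1 _ _ _ _ g1 g2 gi2 gj2) (H2 _ _ _ _ gi2 gj2 g3 g4).
have hw' : a <= w <= b by slra. have hw2 : a < w <= b by slra.
have hc : a < c <= b by slra.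
have nw : ~ critical gamma w.
  move: hw2 => /andP[aw]; rewrite le_eqVlt => /orP[/eqP ->//|wb].
  by apply: regular; rewrite aw.
have := wd i c w hc hw2; rewrite gi => /(_ isT).
case giw: (gamma i w) => [xw|] // _.
have := wd j c w hc hw2; rewrite gj => /(_ isT).
case gjw: (gamma j w) => [yw|] // _.
have [e e0 order] := regular_order hw'.
have near v z1 z2 : a <= v <= b -> `|w - v| < e -> gamma i v = Some z1 ->
    gamma j v = Some z2 ->
    (coordinate yw s <= coordinate xw s)%E = (coordinate z2 s <= coordinate z1 s)%E.
  move=> hv wv g1 g2.
  have strict (k k' : 'I_N) r r' z z' : gamma k w = Some r -> gamma k' w = Some r' ->
      gamma k v = Some z -> gamma k' v = Some z' ->
      (coordinate r s < coordinate r' s)%E -> (coordinate z s < coordinate z' s)%E.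
    move=> gr gr' gz gz' rr.
    apply: le_lt_trans (order v hv wv _ _ _ _ _ _ _ _ gr gr' gz gz' rr).
    by rewrite leeDl // lee_fin; slra.
  have [xy|yx|xy] := ltgtP (coordinate xw s) (coordinate yw s).
  - by apply/esym/negbTE; rewrite -ltNge; exact: strict giw gjw g1 g2 xy.
  - by apply/esym/ltW; exact: strict gjw giw g2 g1 yx.
  - have [[ij]|xo] := regular_eq nw giw gjw xy.
      by move: g2; rewrite -ij g1 => -[->]; rewrite lexx.
    rewrite (infinite_stays hw' hv giw g1 xo) (infinite_stays hw' hv gjw g2) ?leey //.
    by rewrite -xy.
exists e => // c1 d1 h1 h2 h3 h4 z1 z2 z3 z4 g1 g2 g3 g4.
have hc1 : a <= c1 <= b by slra. have hd1 : a <= d1 <= b by slra.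
have wc1 : `|w - c1| < e by rewrite ltr_norml; slra.
have wd1 : `|w - d1| < e by rewrite ltr_norml; slra.
by rewrite -(near c1 z1 z2 hc1 wc1 g1 g2); exact: near hd1 wd1 g3 g4.
Qed.

Variable cen : 'I_N -> option (point R).
Hypothesis cenP : center_at a cen.
Hypothesis gap : sep (4 * `|a - b|) cen.
Hypothesis unique_coincidence : forall k k' m m', coincide gamma a k k' ->
  coincide gamma a m m' -> (k = m /\ k' = m') \/ (k = m' /\ k' = m).

Lemma gap_left t : a < t <= b -> 2 * `|a - t| < 4 * `|a - b|.
Proof. by move=> ht; rewrite !ler0_norm ?subr_le0; slra. Qed.

(* Two vines compared at a in the same way stay so: only one pair of critical
   heights can meet at a, and its order afterwards is fixed by compatibility. *)
Lemma le_after i j r y t p q : cen j = Some r -> cen i = Some y -> ple r y ->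
  ~ forwards_incompatible_by gamma a i j -> a < t <= b ->
  gamma j t = Some q -> gamma i t = Some p -> ple q p.
Proof.
move=> cj ci ry compat ht gj gi.
have ht' : a <= t <= b by slra.
have [ji|ji] := eqVneq j i.
  by move: gj; rewrite ji gi => -[->]; rewrite /ple !lexx.
have ne (s : bool) : (j, s) != (i, s) by apply/eqP => -[/eqP]; apply/negP.
have [r' + /points_closeP rq] := cen_some cenP ht' gj; rewrite cj => -[rr].
have [y' + /points_closeP yp] := cen_some cenP ht' gi; rewrite ci => -[yy].
rewrite -{}rr {r'} in rq; rewrite -{}yy {y'} in yp.
have rys s : (coordinate r s <= coordinate y s)%E.
  by case: s; case/andP: ry; rewrite /= ?lee_fin.
have strict s : (coordinate r s < coordinate y s)%E ->
    (coordinate q s <= coordinate p s)%E.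
  move=> lt; have lt4 := gap cj ci lt.
  have := lt_shift (z := 0) (cen_fin cenP s cj) lt lt4 (rq s).2 (yp s).1.
  rewrite adde0 => H; apply/ltW/H; have := gap_left ht; slra.
have inf s : coordinate r s = +oo%E -> (coordinate q s <= coordinate p s)%E.
  move=> ro; have := rys s; rewrite ro leye_eq => /eqP yo.
  by have := (yp s).1; rewrite yo; case: (coordinate p s) => [x| |] // _; exact: leey.
have other (s s' : bool) : coincide gamma a (j, s) (i, s) -> s != s' ->
    (coordinate q s' <= coordinate p s')%E.
  move=> co ss; have := rys s'; rewrite le_eqVlt => /orP[/eqP ee|]; last exact: strict.
  have [co'|] := cen_coincide cenP cj ci (ne s') ee; last exact: inf.
  have [[[]]|[[]]] := unique_coincidence co co'; last by move=> /eqP; rewrite (negbTE ji).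
  by move=> s1' _; rewrite s1' eqxx in ss.
suff le s : (coordinate q s <= coordinate p s)%E.
  by rewrite /ple -lee_fin; apply/andP; split; [exact: le false|exact: le true].
have := rys s; rewrite le_eqVlt => /orP[/eqP ee|]; last exact: strict.
have [co|] := cen_coincide cenP cj ci (ne s) ee; last exact: inf.
(* A vine missing at a would give a second coincidence besides that of i and j. *)
have present k x : cen k = Some x -> gamma k a = Some x.
  move=> ck; case gk: (gamma k a) => [x'|].
    by have := cen_supp cenP gk; rewrite ck.
  have [_ co'] := cen_absent cenP ck gk.
  have [[[j1 _] [i1 _]]|[[j1 _] [i1 _]]] := unique_coincidence co co';
  by rewrite j1 i1 eqxx in ji.
(* Compatibility yields the order at one time t' inside the segment; [le_persists] carries it to
   t. *)
have [t' ht'' [q' [p' [gq' gp' qp1 qp2]]]] : exists2 t', a < t' < b &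
    vine_le (gamma j) (gamma i) t'.
  apply: contrapT => H; apply: compat; split.
    exists r, y; split; [exact: present|exact: present| |].
      by case/andP: ry.
    by case/andP: ry.
  exists (b - a) => [|t' ht'' le']; first by slra.
  by apply: H; exists t' => //; slra.
have htb : a < t' <= b by slra.
rewrite (le_persists s ht htb gi gj gp' gq').
by case: (s); rewrite //= lee_fin.
Qed.

Lemma left_alive i j p q r t : a < t <= b -> gamma i a = Some p ->
  gamma j t = Some q -> cen j = Some r ->
  alv (gamma j t) (p.1 + `|a - t|) = (r.1 <= p.1) && (p.1%:E < r.2)%E.
Proof.
move=> ht gi gj cj; have ht' : a <= t <= b by slra.
apply: (center_out_alive gap _ _ (gap_left ht) gi gj cj).
  by move=> k x; exact: cen_supp.
by move=> k x; exact: cen_some.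
Qed.

Lemma left_lift (C L : 'M[F]_N) : is_ext_basis (gamma ^~ b) (fam C b) ->
  tr_matrix gamma (B a) (fam C b) L ->
  exists f : R -> 'M[F]_N, [/\ f b = C,
    forall s t, a < s <= b -> a < t <= b -> transported s t (f s) (f t) &
    forall t, a < t <= b -> tr_matrix gamma (B a) (fam (f t) t) L].
Proof.
move=> Cb HL; have [f [fb fJ]] := transport_left b_regular Cb.
exists f; split=> // t ht; have ht' : a <= t <= b by slra.
have hb : a < b <= b by slra.
have tb := fJ t b ht hb; have [ft fb' _] := tb; rewrite fb in fb' tb.
have [M HM] := tr_matrix_exists (B a) ft.
suff -> : L = M by [].
apply/matrixP => j i; case gi: (gamma i a) => [p|]; last by rewrite HL.1 ?HM.1.
have [La LE] := HL.2 i p gi; have [Ma ME] := HM.2 i p gi.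
have eab : `|a - b| = `|a - t| + `|t - b|.
  by rewrite !ler0_norm ?subr_le0; slra.
(* The description of aliveness in [left_alive] does not depend on the time, so the column of M has
   an admissible support at b as well, where M and L are compared. *)
have Ma' k : M k i != 0 -> alv (gamma k b) (p.1 + `|a - b|).
  move=> /Ma; case gt: (gamma k t) => [q|] //.
  have [r ck _] := cen_some cenP ht' gt.
  rewrite -gt (left_alive ht gi gt ck).
  have := supp_regular_right k b_regular ht hb; rewrite gt.
  case gb: (gamma k b) => [q'|] // _.
  by rewrite -gb (left_alive hb gi gb ck).
apply: (expand_inj fb' La Ma').
rewrite -LE.
have e1 : p.1 + `|a - t| + `|t - b| <= p.1 + `|a - b| by slra.
rewrite -(tr_comp _ (in_span aab) (in_span ht') (in_span bab) (lexx _) e1) ME.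
rewrite linear_sum; apply: eq_bigr => k _; rewrite linearZ /=.
have [->|/Ma] := eqVneq (M k i) 0; first by rewrite !scale0r.
case gt: (gamma k t) => [q|] //= /andP[qp _].
rewrite (transported_push ht' bab tb gt) //.
by rewrite -(supp_regular_right k b_regular ht hb) gt.
Qed.

Lemma left_family (C L : 'M[F]_N) : is_ext_basis (gamma ^~ b) (fam C b) ->
  tr_matrix gamma (B a) (fam C b) L ->
  exists f : R -> 'M[F]_N,
  [/\ fam (f a) a = B a, f b = C,
      ext_bases gamma a b (fun t => fam (f t) t),
      for_close a b (fun s t => a < s ->
        Mat (fam (f s) s) (fam (f t) t) (alpha V s t) =
        pi_mx F (S_ gamma s :&: S_ gamma t)) &
      forall t, a < t <= b -> Mat (fam (f a) a) (fam (f t) t) (alpha V a t) = L].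
Proof.
move=> Cb HL; have [f [fb fJ fL]] := left_lift Cb HL.
(* The identity matrix at a keeps the given basis there. *)
pose f' t := if t == a then 1%:M else f t.
have f'E t : a < t -> f' t = f t by move=> at_; rewrite /f' gt_eqF.
have f'a : fam (f' a) a = B a by rewrite /f' eqxx; exact: mx_act1 (Bbasis aab).
exists f'; split=> //.
- by rewrite f'E.
- move=> t /andP[]; rewrite le_eqVlt => /orP[/eqP <- _|at_ tb].
    by rewrite f'a; exact: Bbasis aab.
  by rewrite f'E //; have [] := fJ t t; rewrite ?at_.
- move=> u /andP[]; rewrite le_eqVlt => /orP[/eqP <- _|au ub].
    (* Vacuous for u = a: both s and t are larger than a, so any delta serves. *)
    exists 1 => // s t h1 st h2 ast _ as_.
    by exfalso; case: ast => e; slra.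
  pose J (t : R) := is_true (a < t <= b).
  have [||||d d0 H] := @transported_Mat f' J u.
  + by move=> t; rewrite /J; slra.
  + by move=> i t v; apply: supp_regular_right.
  + by move=> t v /[dup] ht /andP[at_ _] /[dup] hv /andP[av _];
      rewrite !f'E //; exact: fJ.
  + by rewrite /J au ub.
  exists d => // s t h1 st tb ust std as_; apply: H => //; rewrite /J; slra.
move=> t ht; have ht' : a <= t <= b by slra.
rewrite f'a f'E; last by case/andP: ht.
have [ftb _ _] := fJ t t ht ht; have at_ : a < t by case/andP: ht.
by apply: (Mat_tr_matrix (in_span aab) (in_span ht') (Bbasis aab) ftb at_);
  exact: fL.
Qed.

(** A vine j that receives a contribution has an off-diagonal central point, hence is present at a.
    Rows of vines that appear at a therefore vanish, as do their columns. *)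
Lemma left_entry i j : A j i != 0 -> exists p r, [/\ gamma i a = Some p,
  gamma j a = Some r, ple r p & alv (gamma j b) (p.1 + `|a - b|)].
Proof.
move=> Aji; case gi: (gamma i a) => [p|]; last first.
  by move: Aji; rewrite end_matrix.1 // eqxx.
have [/(_ j Aji) alj _] := end_matrix.2 i p gi.
have := alj; case gj: (gamma j b) => [q|] // _.
have [r cj _] := cen_some cenP bab gj.
have hb : a < b <= b by slra.
have [||r1 r2 r3] := center_out gamma_proper (in_span aab) (in_span bab)
  (Bbasis aab) (Bbasis bab) gap (cen_fin cenP) _ _ (gap_left hb) end_matrix
  Aji gi gj cj.
- by move=> k x; exact: cen_supp.
- by move=> k x; exact: cen_some.
exists p, r; split=> //; [|by rewrite /ple r1 r3|by rewrite -gj].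
by apply: (cen_proper cenP cj); apply: le_lt_trans r2; rewrite lee_fin.
Qed.

Lemma left_diag i : isSome (gamma i a) -> A i i != 0.
Proof.
case gi: (gamma i a) => [p|] // _; have hb : a < b <= b by slra.
have [M HM] := tr_matrix_exists (B b) (Bbasis aab).
have [| | |//] := center_diag gamma_proper gamma_simple (in_span aab)
  (in_span bab) (Bbasis aab) (Bbasis bab) gap (cen_fin cenP) _ _ _
  (gap_left hb) end_matrix HM gi.
- by move=> k x; exact: cen_supp.
- by move=> k x; exact: cen_some.
- by move=> k x; exact: cen_proper.
Qed.

Lemma left_alive_diag i p t : a < t <= b -> gamma i a = Some p ->
  alv (gamma i t) (p.1 + `|a - t|).
Proof.
move=> ht gi; have hm := supp_closed aab midtimeP (i := i).
move: hm; rewrite gi => /(_ isT) gm.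
have ht' : a < midtime <= b by have := midtimeP; slra.
move: gm; rewrite (supp_regular_right i b_regular ht' ht).
case gt: (gamma i t) => [q|] // _; rewrite -gt.
by rewrite (left_alive ht gi gt (cen_supp cenP gi)) lexx (gamma_proper gi).
Qed.

Lemma supp_right i t : a < t <= b -> isSome (gamma i a) -> isSome (gamma i t).
Proof.
move=> ht; case gi: (gamma i a) => [p|] // _.
by have := left_alive_diag ht gi; case: (gamma i t).
Qed.

Lemma birth_right i p q : gamma i a = Some p -> gamma i b = Some q ->
  q.1 <= p.1 + `|a - b|.
Proof. exact: birth_lipschitz. Qed.

(** The image of the i-th element at a is by definition the i-th element of A applied to the old
    basis, so in the new basis its matrix is a projection. For a vine that appears at a, the column
    of A is zero and [fill_diag] keeps the old element. *)
Lemma left_compatible : forwards_compatible gamma a ->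
  exists f : R -> 'M[F]_N,
  [/\ fam (f a) a = B a, f b = fill_diag A,
      ext_bases gamma a b (fun t => fam (f t) t) &
      for_close a b (fun s t =>
        Mat (fam (f s) s) (fam (f t) t) (alpha V s t) =
        pi_mx F (S_ gamma s :&: S_ gamma t))].
Proof.
move=> compat; have hb : a < b <= b by slra.
have tri i j p q : gamma i b = Some p -> gamma j b = Some q ->
    fill_diag A j i != 0 -> ple q p.
  move=> gi gj /fill_diag_neq0[ji|/left_entry[y [r [gia gja ry _]]]].
    by move: gj; rewrite ji gi => -[->]; rewrite /ple !lexx.
  apply: (le_after (cen_supp cenP gja) (cen_supp cenP gia) ry _ hb gj gi).
  by move=> inc; apply: compat; exists i, j.
have Cb : is_ext_basis (gamma ^~ b) (fam (fill_diag A) b).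
  apply: (tri_ext_basis (Bbasis bab) (@gamma_proper b) (@gamma_simple b) tri).
  by move=> i _; exact: fill_diag_diag.
have [|f [fa fb fbas fclose fL]] := @left_family _ (pi_mx F (S_ gamma a)) Cb.
  split=> [i j gi|i p gi]; first by rewrite pi_mxE inE gi andbF.
  have iS : i \in S_ gamma a by rewrite inE gi.
  split=> [j|].
    rewrite pi_mxE iS andbT; case: (eqVneq j i) => [-> _|]; last by rewrite eqxx.
    exact: left_alive_diag.
  have [_ ->] := end_matrix.2 i p gi; rewrite sum_pi_mx //.
  have := @supp_right i b hb; rewrite gi => /(_ isT).
  case gb: (gamma i b) => [q|] // _.
  rewrite (elt_mx_act (Bbasis bab) tri gb (birth_right gi gb)).
  by apply: eq_bigr => j _; rewrite fill_diag_eq // left_diag ?gi.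
exists f; split=> // u hu; have [d d0 H] := fclose u hu.
exists d => // s t as_ st tb ust std; move: (as_); rewrite le_eqVlt.
move=> /orP[/eqP e|as']; last exact: H.
have ht : a < t <= b by slra.
rewrite -e fL //; congr pi_mx; apply/esym/finset.setIidPl/fintype.subsetP => i.
by rewrite !inE; exact: supp_right.
Qed.

Lemma mul_e_mxE (M : 'M[F]_N) l k mu j i :
  (M *m e_mx l k mu) j i = M j i + mu * M j l * (i == k)%:R.
Proof.
rewrite /e_mx mulmxDr mulmx1 -scalemxAr !mxE; congr (_ + _).
rewrite -mulrA; congr (_ * _); rewrite (bigD1 l) //= big1 => [|m ml].
  by rewrite mxE eqxx /= addr0 eq_sym.
by rewrite mxE (negbTE ml) mulr0.
Qed.

Lemma e_mx_piE (S : {set 'I_N}) l k mu j i :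
  (e_mx l k mu *m pi_mx F S) j i =
  ((j == i)%:R + mu * ((j == l) && (i == k))%:R) * (i \in S)%:R.
Proof. by rewrite mul_mx_diag /e_mx !mxE. Qed.

(** Both pairs have the same coincidence, so they agree or are swapped. A swap would order the two
    points at a both ways, making them equal. *)
Lemma incompatible_unique k l i j : forwards_incompatible_by gamma a k l ->
  forwards_incompatible_by gamma a i j -> (i, j) = (k, l).
Proof.
move=> inc inc'; have [kl [s co]] := incompatible_coincide inc.
have [_ [s' co']] := incompatible_coincide inc'.
have [[[-> _] [-> _]]//|[[li _] [kj _]]] := unique_coincidence co co'.
have [[pl [pk [gl gk lk1 lk2]]] _] := inc.
have [[p [q [gj gi pq1 pq2]]] _] := inc'.
move: gj gi; rewrite -li -kj gl gk => -[ep] [eq]; rewrite -ep -eq in pq1 pq2.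
move/eqP: kl; case; apply: (gamma_simple (t := a) gk); rewrite gl; congr Some.
case: pl pk {ep eq gl gk} lk1 lk2 pq1 pq2 => [u1 u2] [v1 v2] /= *.
by congr (_, _); apply/le_anti/andP.
Qed.

(** Multiplication by [e_mx l k (- lambda)] subtracts lambda times column l from column k, and
    lambda is chosen to make entry (l, k) zero. The image of the k-th element at a is then the k-th
    new element plus lambda times the l-th one. *)
Lemma left_incompatible k l : forwards_incompatible_by gamma a k l ->
  let lambda := A l k / A l l in exists f : R -> 'M[F]_N,
  [/\ fam (f a) a = B a, f b = A *m e_mx l k (- lambda),
      ext_bases gamma a b (fun t => fam (f t) t),
      for_close a b (fun s t => a < s ->
        Mat (fam (f s) s) (fam (f t) t) (alpha V s t) =
        pi_mx F (S_ gamma s :&: S_ gamma t)) &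
      for_close a b (fun s t => s = a ->
        Mat (fam (f s) s) (fam (f t) t) (alpha V s t) =
        e_mx l k lambda *m pi_mx F (S_ gamma a))].
Proof.
move=> inc lambda; have hb : a < b <= b by slra.
have [kl [s0' co]] := incompatible_coincide inc.
have [[pl [pk [gl gk lk1 lk2]]] _] := inc.
have lk : ple pl pk by rewrite /ple lk1.
have lk0 : l != k by rewrite eq_sym.
have notkl : ~ ple pk pl.
  move=> /andP[h1 h2]; move/eqP: kl; apply.
  apply: (gamma_simple (t := a) gk); rewrite gl; congr Some.
  case: (pl) (pk) lk1 lk2 h1 h2 => [u1 u2] [v1 v2] /= *.
  by congr (_, _); apply/le_anti/andP.
have only i j : forwards_incompatible_by gamma a i j -> (i, j) = (k, l).
  exact: incompatible_unique inc.
have after i j y r p q : (i, j) <> (k, l) -> gamma i a = Some y ->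
    gamma j a = Some r -> ple r y -> gamma i b = Some p ->
    gamma j b = Some q -> ple q p.
  move=> ne gia gja ry gi gj.
  apply: (le_after (cen_supp cenP gja) (cen_supp cenP gia) ry _ hb gj gi).
  by move=> /only.
(* No vine appears at a, because that would be a second coincidence; hence A has a nonzero diagonal
   entry for every vine present at b. *)
have from_a i : isSome (gamma i b) -> isSome (gamma i a).
  case gi: (gamma i b) => [q|] // _; case gia: (gamma i a) => [p|] //.
  have [r ci _] := cen_some cenP bab gi.
  have [_ co'] := cen_absent cenP ci gia.
  have [[[li _] [ki _]]|[[li _] [ki _]]] := unique_coincidence co co';
  by rewrite li ki eqxx in kl.
have All : A l l != 0 by rewrite left_diag ?gl.
have CE j i : (A *m e_mx l k (- lambda)) j i = A j i - lambda * A j l * (i == k)%:R.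
  by rewrite mul_e_mxE !mulNr.
have tri i j p q : gamma i b = Some p -> gamma j b = Some q ->
    (A *m e_mx l k (- lambda)) j i != 0 -> ple q p.
  move=> gi gj; rewrite CE; have [ij|/eqP ij] := eqVneq (i, j) (k, l).
    by move: ij => [-> ->]; rewrite eqxx mulr1 divfK // subrr eqxx.
  have [Aji|/left_entry[y [r [gia gja ry _]]] _] := eqVneq (A j i) 0; last first.
    exact: after ij gia gja ry gi gj.
  rewrite Aji sub0r oppr_eq0; have [ik|_] := eqVneq i k; last by rewrite mulr0 eqxx.
  rewrite mulr1 mulf_eq0 negb_or => /andP[_ /left_entry[y [r [gla gja ry _]]]].
  move: gla; rewrite gl => -[ey]; rewrite -{}ey {y} in ry.
  have gia : gamma i a = Some pk by rewrite ik.
  apply: after ij gia gja _ gi gj; case/andP: ry => ry1 ry2.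
  by rewrite /ple (le_trans ry1 lk1) (le_trans ry2 lk2).
(* Makes the subtraction leave the diagonal entry (k, k) unchanged. *)
have Akl : A k l = 0.
  apply/eqP; apply: contraT => /left_entry[y [r [+ + ry _]]].
  by rewrite gl gk => -[ey] [er]; case: notkl; rewrite ey er.
have Cb : is_ext_basis (gamma ^~ b) (fam (A *m e_mx l k (- lambda)) b).
  apply: (tri_ext_basis (Bbasis bab) (@gamma_proper b) (@gamma_simple b) tri).
  move=> i gi; rewrite CE; have [->|_] := eqVneq i k.
    by rewrite Akl mulr0 mul0r subr0 left_diag // gk.
  by rewrite mulr0 subr0 left_diag // from_a.
have [|f [fa fb fbas fclose fL]] :=
    @left_family _ (e_mx l k lambda *m pi_mx F (S_ gamma a)) Cb.
  split=> [i j gi|i p gi]; first by rewrite e_mx_piE inE gi mulr0.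
  have iS : i \in S_ gamma a by rewrite inE gi.
  split=> [j|].
    rewrite e_mx_piE iS mulr1; have [-> _|ji] := eqVneq j i.
      exact: left_alive_diag.
    rewrite add0r; have [jl|_] := eqVneq j l; last by rewrite mulr0 eqxx.
    have [ik|_] := eqVneq i k; last by rewrite mulr0 eqxx.
    rewrite mulr1 mulf_eq0 negb_or => /andP[/left_entry[y [r [+ _ _ +]]] _].
    by rewrite jl -ik gi => -[->].
  have [_ ->] := end_matrix.2 i p gi.
  have famE m x : gamma m a = Some x -> x.1 <= p.1 ->
      elt (fam (A *m e_mx l k (- lambda)) b m) (p.1 + `|a - b|) =
      \sum_(j < N) (A j m - lambda * A j l * (m == k)%:R) *:
        elt (B b j) (p.1 + `|a - b|).
    move=> gm xp; have := @supp_right m b hb; rewrite gm => /(_ isT).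
    case gb: (gamma m b) => [q|] // _.
    have qx := birth_right gm gb.
    rewrite (elt_mx_act (Bbasis bab) tri gb); last by slra.
    by apply: eq_bigr => j _; rewrite CE.
  (* Column i of the elementary matrix selects the i-th new element, with lambda times the l-th one
     added when i = k. *)
  have -> : \sum_(j < N) (e_mx l k lambda *m pi_mx F (S_ gamma a)) j i *:
      elt (fam (A *m e_mx l k (- lambda)) b j) (p.1 + `|a - b|) =
      elt (fam (A *m e_mx l k (- lambda)) b i) (p.1 + `|a - b|) +
      (lambda * (i == k)%:R) *:
      elt (fam (A *m e_mx l k (- lambda)) b l) (p.1 + `|a - b|).
    rewrite (elt_delta _ i) (elt_delta _ l) scaler_sumr -big_split /=.
    apply: eq_bigr => j _; rewrite e_mx_piE iS mulr1 scalerA -scalerDl.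
    by rewrite -mulnb natrM [(j == l)%:R * _]mulrC mulrA.
  rewrite (famE i p gi (lexx _)); have [ik|ik] := eqVneq i k; last first.
    rewrite mulr0 scale0r addr0; apply: eq_bigr => j _.
    by rewrite mulr0 subr0.
  have pp : p = pk by move: gi; rewrite ik gk => -[].
  rewrite (famE l pl gl) ?pp // (negbTE lk0) scaler_sumr -big_split /=.
  apply: eq_bigr => j _; rewrite scalerA -scalerDl; congr (_ *: _); ring.
(* The matrix from a is the same for every t in (a, b], so any delta serves. *)
exists f; split=> // u hu; exists 1 => // s t as_ st tb _ _ sa; subst s.
by apply: fL; slra.
Qed.

End LeftCentered.

(** * Segments compared with the diagram at the right endpoint *)

Section RightCentered.
Hypothesis a_regular : ~ critical gamma a.
Variable cen : 'I_N -> option (point R).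
Hypothesis cenP : center_at b cen.
Hypothesis gap : sep (4 * `|a - b|) cen.

Lemma gap_right t : a <= t < b -> 2 * `|b - t| < 4 * `|a - b|.
Proof.
by move=> ht; rewrite (@ger0_norm _ (b - t)) ?(@ler0_norm _ (a - b)); slra.
Qed.

Lemma right_alive i j p q r t : a <= t < b -> gamma i t = Some q ->
  cen i = Some r -> gamma j b = Some p ->
  alv (gamma j b) (q.1 + `|t - b|) = (p.1 <= r.1) && (r.1%:E < p.2)%E.
Proof.
move=> ht gi ci gj; have ht' : a <= t <= b by slra.
rewrite distrC; apply: (center_in_alive gap _ _ (gap_right ht) gi ci gj).
  by move=> k x; exact: cen_supp.
by move=> k x; exact: cen_some.
Qed.

Lemma right_entry i j : A j i != 0 -> exists p r, [/\ cen i = Some r,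
  gamma j b = Some p, ple p r & r.1%:E < p.2]%E.
Proof.
move=> Aji; case gi: (gamma i a) => [q|]; last first.
  by move: Aji; rewrite end_matrix.1 // eqxx.
have [/(_ j Aji) + _] := end_matrix.2 i q gi.
case gj: (gamma j b) => [p|] // _.
have [r ci _] := cen_some cenP aab gi.
have ha : a <= a < b by slra.
have [||p1 p2 p3] := center_in gamma_proper (in_span bab) (in_span aab)
  (Bbasis bab) (Bbasis aab) gap (cen_fin cenP) _ _ (gap_right ha) end_matrix
  Aji gi ci gj.
- by move=> k x; exact: cen_supp.
- by move=> k x; exact: cen_some.
by exists p, r; split=> //; rewrite /ple p1 p3.
Qed.

Lemma right_diag i : isSome (gamma i b) -> A i i != 0.
Proof.
case gi: (gamma i b) => [p|] // _; have ha : a <= a < b by slra.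
have [M HM] := tr_matrix_exists (B b) (Bbasis aab).
have [| | |//] := center_diag gamma_proper gamma_simple (in_span bab)
  (in_span aab) (Bbasis bab) (Bbasis aab) gap (cen_fin cenP) _ _ _
  (gap_right ha) HM end_matrix gi.
- by move=> k x; exact: cen_supp.
- by move=> k x; exact: cen_some.
- by move=> k x; exact: cen_proper.
Qed.

(** The basis at a is propagated forwards over [a, b), and [fill_diag A] is used at b. Here A is
    triangular for the order at b itself, which is the order that [tri_ext_basis] asks for there. *)
Lemma right_compatible : exists f : R -> 'M[F]_N,
  [/\ fam (f a) a = B a, f b = fill_diag A,
      ext_bases gamma a b (fun t => fam (f t) t) &
      for_close a b (fun s t =>
        Mat (fam (f s) s) (fam (f t) t) (alpha V s t) =
        pi_mx F (S_ gamma s :&: S_ gamma t))].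
Proof.
have ha : a <= a < b by slra.
have fam1 : fam 1%:M a = B a by exact: mx_act1 (Bbasis aab).
have [|f [fa fJ]] := @transport_right 1%:M a_regular.
  by rewrite fam1; exact: Bbasis aab.
have tri i j p q : gamma i b = Some p -> gamma j b = Some q ->
    fill_diag A j i != 0 -> ple q p.
  move=> gi gj /fill_diag_neq0[ji|/right_entry[p' [r [ci gj' pr _]]]].
    by move: gj; rewrite ji gi => -[->]; rewrite /ple !lexx.
  move: ci gj'; rewrite (cen_supp cenP gi) gj => -[->] [->].
  exact: pr.
have Cb : is_ext_basis (gamma ^~ b) (fam (fill_diag A) b).
  apply: (tri_ext_basis (Bbasis bab) (@gamma_proper b) (@gamma_simple b) tri).
  by move=> i _; exact: fill_diag_diag.
pose f' t := if t == b then fill_diag A else f t.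
have f'E t : t < b -> f' t = f t by move=> tb; rewrite /f' lt_eqF.
have f'b : f' b = fill_diag A by rewrite /f' eqxx.
have last t : a <= t < b -> Mat (fam (f t) t) (fam (fill_diag A) b) (alpha V t b) =
    pi_mx F (S_ gamma t :&: S_ gamma b).
  move=> ht; have ht' : a <= t <= b by slra.
  have [ftb _ _] := fJ t t ht ht; have tb : t < b by case/andP: ht.
  apply: (Mat_tr_matrix (in_span ht') (in_span bab) ftb Cb tb).
  split=> [i j gi|i q gi]; first by rewrite pi_mxE !inE gi /= andbF.
  have := supp_regular_left i a_regular ht ha; rewrite gi.
  case gia: (gamma i a) => [q0|] // _.
  have [r ci _] := cen_some cenP ht' gi.
  have [M HM] := tr_matrix_exists (fam (f t) t) (Bbasis bab).
  have [Ma ME] := HM.2 i q gi; have [Aa AE] := end_matrix.2 i q0 gia.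
  have eab : `|a - b| = `|a - t| + `|t - b| by rewrite !ler0_norm ?subr_le0; slra.
  (* The i-th element at t is the image of the i-th one at a, so continuing to b gives the image
     under the full map; by [right_alive] the supports agree too. *)
  have MA j : M j i = A j i.
    have Ma' k : M k i != 0 -> alv (gamma k b) (q0.1 + `|a - b|).
      move=> /Ma; case gb: (gamma k b) => [p|] //.
      by rewrite -gb (right_alive ht gi ci gb) (right_alive ha gia ci gb).
    apply: (expand_inj (Bbasis bab) Ma' Aa); rewrite -AE.
    have e1 : q0.1 + `|a - t| + `|t - b| <= q0.1 + `|a - b| by slra.
    rewrite -(tr_comp _ (in_span aab) (in_span ht') (in_span bab) (lexx _) e1).
    have E := transported_push aab ht' (fJ a t ha ht) gia _ (lexx _) (lexx _).
    rewrite -{1}fam1 -fa E ?gi //.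
    have qq := birth_lipschitz aab ht' gia gi.
    by rewrite (tr_matrix_push (in_span ht') (in_span bab) ftb (Bbasis bab) HM gi qq e1).
  case gb: (gamma i b) => [p|]; last first.
    (* Vine i disappears at b with central point (v, v). A contribution to j would give j a death
       above v and at most v. *)
    have M0 j : M j i = 0.
      apply/eqP; apply: contraT; rewrite MA => /right_entry[p [r' [ci' _ pr rp]]].
      move: ci'; rewrite ci => -[rr]; rewrite -{}rr {r'} in pr rp.
      have [rd _] := cen_absent cenP ci gb; move: pr; rewrite /ple rd => /andP[_ pr].
      by move: (lt_le_trans rp pr); rewrite ltxx.
    have pi0 j : (pi_mx F (S_ gamma t :&: S_ gamma b)) j i = 0.
      by rewrite pi_mxE !inE gb !andbF.
    split=> [j|]; first by rewrite pi0 eqxx.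
    rewrite ME !big1 // => j _; by rewrite ?pi0 ?M0 scale0r.
  have iS : i \in S_ gamma t :&: S_ gamma b by rewrite !inE gi gb.
  split=> [j|].
    rewrite pi_mxE iS andbT; case: (eqVneq j i) => [-> _|]; last by rewrite eqxx.
    have := cen_supp cenP gb; rewrite ci => -[rp].
    by rewrite (right_alive ht gi ci gb) -rp lexx rp (gamma_proper gb).
  rewrite sum_pi_mx // ME (elt_mx_act (Bbasis bab) tri gb); last first.
    exact: birth_lipschitz gi gb.
  by apply: eq_bigr => j _; rewrite MA fill_diag_eq // right_diag ?gb.
exists f'; split=> //.
- by rewrite f'E // fa.
- move=> t /andP[at_]; rewrite le_eqVlt => /orP[/eqP ->|tb]; first by rewrite f'b.
  by rewrite f'E //; have [] := fJ t t; rewrite ?at_.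
move=> u /andP[au]; rewrite le_eqVlt => /orP[/eqP ->|ub].
  exists 1 => // s t as_ st tb bst _; case: bst => e.
    by exfalso; slra.
  by move: st; rewrite -e => sb; rewrite f'b f'E //; apply: last; rewrite as_.
pose J (t : R) := is_true (a <= t < b).
have [||||d d0 H] := @transported_Mat f' J u.
+ by move=> t; rewrite /J; slra.
+ by move=> i t v; apply: supp_regular_left.
+ by move=> t v /[dup] ht /andP[_ tb] /[dup] hv /andP[_ vb];
    rewrite !f'E //; exact: fJ.
+ by rewrite /J au ub.
exists d => // s t as_ st tb ust std.
have sb : s < b by slra.
move: tb; rewrite le_eqVlt => /orP[/eqP e|tb]; last by apply: H => //; rewrite /J; slra.
by subst t; rewrite f'b f'E //; apply: last; rewrite as_.
Qed.

End RightCentered.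

End Interval.

Theorem proposition5p9 (F : fieldType) (R : realType) (s0 s1 : R)
    (V : vineyard_module F s0 s1) (N : nat)
    (gamma : 'I_N -> R -> option (point R))
    (gammaV : is_vineyard_of V gamma) (standing : standing_assumptions gamma)
    (Tm Tm1 : R) (seg : is_segment s0 s1 gamma Tm Tm1)
    (Bold : forall t : R, ext_family N (V t))
    (Bold_basis : ext_bases gamma Tm Tm1 Bold) :
  exists Bnew : forall t : R, ext_family N (V t),
    ext_bases gamma Tm Tm1 Bnew /\
    forwards_simplified gamma Tm Tm1 Bold Bnew.
Proof.
have [s0a ab bs1 regular cases] := seg; have [_ unique] := standing.
(* A coincidence already makes its time critical, so the standing assumption becomes available at
   every time. *)
have uniq c k k' m m' : coincide gamma c k k' -> coincide gamma c m m' ->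
    (k = m /\ k' = m') \/ (k = m' /\ k' = m).
  by move=> co; apply: unique => //; exact: coincide_critical co.
have left : ~ critical gamma Tm1 ->
    (`|Tm - Tm1|%:E <= min_gap gamma Tm * 4^-1%:E)%E ->
    exists Bnew : forall t : R, ext_family N (V t),
      ext_bases gamma Tm Tm1 Bnew /\ forwards_simplified gamma Tm Tm1 Bold Bnew.
  move=> nb gap.
  have [cen cenP] :=
    center_exists gammaV s0a ab bs1 regular Bold_basis (or_introl erefl).
  have gapS := cen_sep gammaV s0a ab bs1 cenP gap.
  have [[k [l inc]]|compat] :=
    pselect (exists k l, forwards_incompatible_by gamma Tm k l).
    have [f [fa fb fbas fclose fstart]] := left_incompatible gammaV s0a ab bs1
      regular Bold_basis nb cenP gapS (@uniq Tm) inc.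
    exists (fun t => fam Bold (f t) t); split=> //.
    split=> [compat|k' l' inc']; first by case: compat; exists k, l.
    have [-> ->] := incompatible_unique gammaV s0a ab bs1 regular Bold_basis
      (@uniq Tm) inc inc'.
    by rewrite /= fa; split=> //; rewrite fb.
  have [f [fa fb fbas fclose]] := left_compatible gammaV s0a ab bs1 regular
      Bold_basis nb cenP gapS (@uniq Tm) compat.
  exists (fun t => fam Bold (f t) t); split=> //.
  split=> [_|k l inc]; last by case: compat; exists k, l.
  by rewrite /= fa; split=> //; rewrite fb.
have e0 : (0 <= (4^-1)%:E :> \bar R)%E by rewrite lee_fin invr_ge0 ler0n.
case: cases => [[na nb gap]|[_ nb gap]|[na _ gap]].
(* With both endpoints regular, the segment is compared with its left endpoint, whose gap is at
   least the minimum of the two. *)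
- apply: left => //; apply: (le_trans gap).
  by apply: lee_wpmul2r => //; rewrite ge_min lexx.
- exact: left.
have [cen cenP] :=
  center_exists gammaV s0a ab bs1 regular Bold_basis (or_intror erefl).
have [f [fa fb fbas fclose]] := right_compatible gammaV s0a ab bs1 regular
    Bold_basis na cenP (cen_sep gammaV s0a ab bs1 cenP gap).
exists (fun t => fam Bold (f t) t); split=> //.
split=> [_|k l inc]; first by rewrite /= fa; split=> //; rewrite fb.
(* A regular T_m is forwards compatible: incompatibility would produce a coincidence there. *)
have [_ [s co]] := incompatible_coincide gammaV s0a ab bs1 regular Bold_basis inc.
by case: na; exact: coincide_critical co.
Qed.
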